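(* The following groups have the DTUT property: (1) Every finitely generated torsion-free nilpotent group of class $m$ has the $(m,0)$-DTUT property. More generally, every finitely generated group with polynomial growth has the $(m,0)$-DTUT property for some $m\in\mathbb{N}$. (2) Every hyperbolic group has the $(1,0)$-DTUT property, and so does any group that is hyperbolic relative to a collection of subgroups, each of which quasi-isometrically embeds into a finite product of metric trees.
   Context: $\mathbb{N}=\{0,1,2,\dots\}$, $\mathbb{N}^+=\{1,2,\dots\}$. All groups are equipped with proper left-invariant metrics (for finitely generated groups, e.g. word metrics for finite generating sets). Metric trees carry the standard path metric. For a metric space $(X,d)$ and $U,V\subseteq X$, $d(U,V)=\inf\{d(x,y)\mid x\in U,y\in V\}$. A family $\mathcal{U}$ of subsets is uniformly bounded if there is $R>0$ such that every member has diameter $\le R$, and $r$-disjoint if $d(U,V)\ge r$ for all distinct $U,V\in\mathcal{U}$. $\bigcup\mathcal{U}$ denotes the union of all members of $\mathcal U$; unions $\bigcup_i\mathcal{U}_i$ of families are families consisting of all their members. DTUT property. For $m,n\in\mathbb{N}$, a metric space $X$ has the $(m,n)$-DTUT property (''disjointness of the $(m,n)$-tiling through uniform translation'') if there exist integers $F_1,\dots,F_m\in\mathbb{N}$ depending only on $X$ such that for every map $h:\mathbb{N}^+\to\mathbb{N}^+$, every sequence $k_0<k_1<\cdots<k_m$ in $\mathbb{N}^+$, and each vector $\vec l=(l_1,\dots,l_m)\in\prod_{r=1}^m\{1,\dots,h(k_r)\}$ there exist uniformly bounded families $\mathcal{C}_0^{\vec l},\dots,\mathcal{C}_n^{\vec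 l}$ and $\mathcal{D}_{i,0}^{\vec l},\dots,\mathcal{D}_{i,F_i}^{\vec l}$ $(1\le i\le m)$ of subsets of $X$ such that: (i) for every $\vec l$, each $\mathcal{C}_j^{\vec l}$ is $k_0$-disjoint, each $\mathcal{D}_{i,s}^{\vec l}$ is $k_i$-disjoint, and all these families (for the fixed $\vec l$) together cover $X$; (ii) for each $1\le i\le m$, $0\le s\le F_i$ and each fixed $(l_1,\dots,l_{i-1},l_{i+1},\dots,l_m)$: for all $1\le t<t'\le h(k_i)$ the sets $\bigcup\mathcal{D}_{i,s}^{l_1,\dots,l_{i-1},t,l_{i+1},\dots,l_m}$ and $\bigcup\mathcal{D}_{i,s}^{l_1,\dots,l_{i-1},t',l_{i+1},\dots,l_m}$ are non-empty and disjoint, and the family $\bigcup_{t=1}^{h(k_i)}\mathcal{D}_{i,s}^{l_1,\dots,l_{i-1},t,l_{i+1},\dots,l_m}$ is $k_i$-disjoint. $X$ has the DTUT property if it has the $(m,n)$-DTUT property for some $m,n\in\mathbb{N}$.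
   Formalization: In part (2) the (1,0)-DTUT property is claimed only for infinite groups, because it fails for every finite group (take h(k_1) larger than the order of the group); finite groups in part (2) are only claimed to have the DTUT property for some m, n. *)

(* Defs.v *)
(* MathComp / MathComp-Analysis.  Metrics are bare functions d : T -> T -> R
   because one group carries several of them; infinite groups are [groupType]. *)
From HB Require Import structures.
From mathcomp Require Import all_boot all_order all_algebra.
From mathcomp Require Import all_classical all_reals all_analysis.

Set Implicit Arguments.
Unset Strict Implicit.
Unset Printing Implicit Defensive.

Import Order.TTheory GRing.Theory Num.Theory.

Local Open Scope classical_set_scope.
Local Open Scope ring_scope.

Definition is_metric (R : realType) (T : Type) (d : T -> T -> R) : Prop :=
  [/\ forall x y, d x y = 0 <-> x = y,
      forall x y, d x y = d y x
    & forall x y z, d x z <= d x y + d y z].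

(** ** Families of subsets *)

(* Extended-real infimum, so that the empty set is at distance +oo from
   every set. *)
Definition set_dist (R : realType) (T : Type) (d : T -> T -> R)
    (U V : set T) : \bar R :=
  ereal_inf [set (d p.1 p.2)%:E | p in U `*` V].

Definition uniformly_bounded (R : realType) (T : Type) (d : T -> T -> R)
    (U : set (set T)) : Prop :=
  exists2 r : R, 0 < r &
    forall A, U A -> forall x y, A x -> A y -> d x y <= r.

Definition disjoint_at (R : realType) (T : Type) (d : T -> T -> R)
    (r : nat) (U : set (set T)) : Prop :=
  forall A B, U A -> U B -> A <> B -> ((r%:R : R)%:E <= set_dist d A B)%E.

Definition union_of (T : Type) (U : set (set T)) : set T := \bigcup_(A in U) A.

(** ** The DTUT property *)

(* The index i : 'I_m stands for i + 1 in {1, ..., m}: the scale attached to it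
   is k_(i+1), that is [k (lift ord0 i)]. *)
Definition translation_vector (m : nat) (h : nat -> nat) (k : 'I_m.+1 -> nat)
    (l : 'I_m -> nat) : Prop :=
  forall i, (1 <= l i <= h (k (lift ord0 i)))%N.

(* The families are functions of the translation vector l, constrained only
   where l is admissible; [dfwith l i t] is the vector l with its
   i-th entry replaced by t.  For 0 < m the property forces X to be infinite:
   the sets union_of (Dt t), 1 <= t <= h k_i, are nonempty and pairwise disjoint
   while h is arbitrary. *)
Definition DTUT (R : realType) (X : Type) (d : X -> X -> R) (m n : nat) : Prop :=
  exists F : 'I_m -> nat,
  forall (h : nat -> nat) (k : 'I_m.+1 -> nat),
    (forall j, (0 < j)%N -> (0 < h j)%N) ->
    (forall i, (0 < k i)%N) ->
    (forall i j : 'I_m.+1, (i < j)%N -> (k i < k j)%N) ->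
  exists (C : ('I_m -> nat) -> 'I_n.+1 -> set (set X))
         (D : ('I_m -> nat) -> forall i : 'I_m, 'I_(F i).+1 -> set (set X)),
    (forall l, translation_vector h k l ->
      [/\ forall j, uniformly_bounded d (C l j) /\
                    disjoint_at d (k ord0) (C l j),
          forall i s, uniformly_bounded d (D l i s) /\
                      disjoint_at d (k (lift ord0 i)) (D l i s)
        & forall x, (exists j, union_of (C l j) x) \/
                    (exists i s, union_of (D l i s) x)])
    /\
    (forall l, translation_vector h k l ->
      forall (i : 'I_m) (s : 'I_(F i).+1),
      let Dt t := D (dfwith l i t) i s in
      let hi := h (k (lift ord0 i)) in
      (forall t t', (1 <= t)%N -> (t < t')%N -> (t' <= hi)%N ->
        [/\ union_of (Dt t) !=set0, union_of (Dt t') !=set0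
          & union_of (Dt t) `&` union_of (Dt t') = set0])
      /\ disjoint_at d (k (lift ord0 i))
           (\bigcup_(t in [set t | (1 <= t <= hi)%N]) Dt t)).

Definition has_DTUT (R : realType) (X : Type) (d : X -> X -> R) : Prop :=
  exists m n, DTUT d m n.

(** ** Graphs and Gromov hyperbolicity *)

Fixpoint walk (T : Type) (E : T -> T -> Prop) (n : nat) (x y : T) : Prop :=
  if n is n'.+1 then exists2 z, E x z & walk E n' z y else x = y.

(* The value is meaningful when x and y are joined by a walk. *)
Definition graph_dist (R : realType) (T : Type) (E : T -> T -> Prop)
    (x y : T) : R :=
  inf [set (n%:R : R) | n in [set n | walk E n x y]].

Definition gromov_product (R : realType) (T : Type) (d : T -> T -> R)
    (w x y : T) : R :=
  (d x w + d y w - d x y) / 2.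

Definition gromov_hyperbolic (R : realType) (T : Type) (d : T -> T -> R) : Prop :=
  exists delta : R, forall w x y z,
    Num.min (gromov_product d w x y) (gromov_product d w y z) - delta
      <= gromov_product d w x z.

(** ** Groups *)

Definition is_subgroup (G : groupType) (H : set G) : Prop :=
  [/\ H 1%g, forall x y, H x -> H y -> H (x * y)%g & forall x, H x -> H x^-1%g].

Definition generated (G : groupType) (S : set G) : set G :=
  smallest (@is_subgroup G) S.

Definition finite_generating (G : groupType) (H S : set G) : Prop :=
  finite_set S /\ generated S = H.

Definition finitely_generated (G : groupType) : Prop :=
  exists S : set G, finite_generating setT S.

Definition proper_left_invariant_metric (R : realType) (G : groupType)
    (d : G -> G -> R) : Prop :=
  [/\ is_metric d,
      forall g x y : G, d (g * x)%g (g * y)%g = d x y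
    & forall (x : G) (r : R), finite_set [set y | d x y <= r]].

Definition torsion_free (G : groupType) : Prop :=
  forall (x : G) (n : nat), (0 < n)%N -> (x ^+ n = 1)%g -> x = 1%g.

(* Indexed from 0: the 0-th term is G itself. *)
Fixpoint lower_central (G : groupType) (n : nat) : set G :=
  if n is n'.+1 then
    generated [set g | exists x y : G, lower_central n' x /\ g = [~ x, y]%g]
  else setT.

Definition nilpotent_of_class (G : groupType) (m : nat) : Prop :=
  lower_central m = [set (1 : G)%g] /\
  forall c, (c < m)%N -> lower_central c <> [set (1 : G)%g].

(** ** Word metrics, growth, hyperbolic groups *)

Definition cayley (G : groupType) (S : set G) (x y : G) : Prop :=
  exists2 s, S s & (y = x * s \/ x = y * s)%g.

Definition word_dist (R : realType) (G : groupType) (S : set G) : G -> G -> R :=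
  graph_dist R (cayley S).

Definition word_ball (G : groupType) (S : set G) (n : nat) : set G :=
  [set g | exists2 j, (j <= n)%N & walk (cayley S) j 1%g g].

Definition polynomial_growth (G : groupType) : Prop :=
  exists S : set G, finite_generating setT S /\
  exists c D : nat, forall n, (0 < n)%N -> (word_ball S n #<= `I_(c * n ^ D)%N)%card.

Definition hyperbolic_group (R : realType) (G : groupType) : Prop :=
  exists S : set G, finite_generating setT S /\
  gromov_hyperbolic (word_dist R S).

(** ** Relatively hyperbolic groups (Groves-Manning cusped space) *)

(* The cusped space is the Cayley graph of G with a combinatorial horoball glued
   to every left coset g P_i.  The vertex [inl g] is g at depth 0 and
   [inr (i, g, n)] is g at depth n + 1 in the horoball over the coset g P_i (the
   coset is determined by i and g).  At depth n + 1, two elements of a coset are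
   adjacent when their distance for the word metric of P_i is at most
   2 ^ (n + 1); loops, which do not affect distances, are not excluded. *)
Definition cusped_adj (G : groupType) (I : finType) (P : I -> set G) (S : set G)
    (u v : G + I * G * nat) : Prop :=
  match u, v with
  | inl x, inl y => cayley S x y
  | inl x, inr (_, y, n) => x = y /\ n = 0%N
  | inr (_, x, n), inl y => x = y /\ n = 0%N
  | inr (i, x, n), inr (j, y, p) =>
      i = j /\
      [\/ n = p /\ word_ball (S `&` P i) (2 ^ n.+1) (x^-1 * y)%g,
          x = y /\ p = n.+1
        | x = y /\ n = p.+1]
  end.

Definition relatively_hyperbolic (R : realType) (G : groupType) (I : finType)
    (P : I -> set G) : Prop :=
  (forall i, is_subgroup (P i)) /\
  exists S : set G,
    [/\ finite_generating setT S,
        forall i, generated (S `&` P i) = P i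
      & gromov_hyperbolic (graph_dist R (cusped_adj P S))].

(** ** Metric trees and quasi-isometric embeddings *)

Definition geodesic_segment (R : realType) (T : Type) (d : T -> T -> R)
    (x y : T) (A : set T) : Prop :=
  exists c : R -> T,
    [/\ c 0 = x, c (d x y) = y,
        forall s t, 0 <= s <= d x y -> 0 <= t <= d x y ->
          d (c s) (c t) = `|s - t|
      & A = [set c t | t in [set t | 0 <= t <= d x y]]].

(* R-trees; this includes every simplicial tree with its path metric, points in
   the interior of edges included. *)
Definition metric_tree (R : realType) (T : Type) (d : T -> T -> R) : Prop :=
  [/\ is_metric d,
      forall x y, exists! A, geodesic_segment d x y A
    & forall x y z A B, geodesic_segment d x y A -> geodesic_segment d y z B ->
        A `&` B = [set y] -> geodesic_segment d x z (A `|` B)].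

Definition l1_dist (R : realType) (N : nat) (T : 'I_N -> Type)
    (d : forall j, T j -> T j -> R) (x y : forall j, T j) : R :=
  \sum_(j < N) d j (x j) (y j).

Definition qi_embedding_on (R : realType) (X Y : Type) (A : set X)
    (dX : X -> X -> R) (dY : Y -> Y -> R) (f : X -> Y) : Prop :=
  exists K c : R, [/\ 1 <= K, 0 <= c &
    forall x y, A x -> A y ->
      K^-1 * dX x y - c <= dY (f x) (f y) <= K * dX x y + c].

(* The subgroup H carries the word metric of one of its own finite generating
   sets, not the metric of the ambient group; values of f off H are irrelevant. *)
Definition qi_embeds_in_trees (R : realType) (G : groupType) (H : set G) : Prop :=
  exists S : set G, finite_generating H S /\
  exists (N : nat) (T : 'I_N -> Type) (d : forall j, T j -> T j -> R)
         (f : G -> forall j, T j),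
    (forall j, metric_tree (d j)) /\
    qi_embedding_on H (word_dist R S) (l1_dist d) f.

(* Main.v *)
(* All these groups have finite asymptotic dimension, and this is enough: if X is
   infinite and proper, take uniformly bounded families U_0, ..., U_n covering X,
   each of them L-disjoint with L much larger than h(k) * k, and let D^t_s consist
   of the shells {x | 2tk <= d(x, U) < 2tk + k}, U in U_s.  Shells of different
   cells or different t are k-disjoint, and removing the shells of one t from X
   leaves k-disjoint bounded pieces, so X is (1, 0)-DTUT.

   Finite asymptotic dimension:
   - polynomial growth gives arbitrarily large scales r at which the ball of radius
     8r has at most C times the size of the ball of radius r; a maximal
     2r-separated set can then be colored with C colors at scale 5r;
   - f.g. nilpotent groups have polynomial growth, by collecting one generator at
     a time;
   - in a hyperbolic graph one cover by finitely many families that are disjoint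
     at a single scale 2 * delta and bounded yields covers for all scales, by
     projecting annuli towards a base point.  For hyperbolic groups such a cover
     is a coloring of a graph of bounded degree.  For relatively hyperbolic groups
     one covers the cusped space, in which the group is coarsely embedded: deep in
     a horoball, at depth n, a cover of the peripheral subgroup at scale about 2^n
     is needed whose bound is linear in the scale, and products of trees provide
     it. *)
Require Import Defs.
From mathcomp Require Import all_boot all_order all_algebra.
From mathcomp Require Import all_classical all_reals all_analysis.
From mathcomp Require Import zify ring lra.

Set Implicit Arguments.
Unset Strict Implicit.
Unset Printing Implicit Defensive.

Import Order.TTheory GRing.Theory Num.Theory.

Local Open Scope classical_set_scope.
Local Open Scope ring_scope.

(* The cells [col = c, lab = y] form a cover by [N] families, one for each color
   [c]: distinct cells of a family are not [close], and a cell is bounded in the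
   sense of [bnd]. *)
Definition colorable (X : Type) (N : nat) (close bnd : X -> X -> Prop) : Prop :=
  exists (Y : Type) (col : X -> nat) (lab : X -> Y),
  [/\ forall x, (col x < N)%N,
      forall x x', col x = col x' -> close x x' -> lab x = lab x'
    & forall x x', col x = col x' -> lab x = lab x' -> bnd x x'].

(** Asymptotic dimension at most [N - 1], in terms of colorings: [N] is fixed before the scale [L],
    while [B] may depend on it. *)
Definition finite_asdim (R : realType) (X : Type) (d : X -> X -> R) : Prop :=
  exists N, forall L : R, exists B : R,
    colorable N (fun x y => d x y <= L) (fun x y => d x y <= B).

Lemma colorable_pullback (X X' : Type) (f : X' -> X) N
    (close bnd : X -> X -> Prop) (close' bnd' : X' -> X' -> Prop) :
  (forall x y, close' x y -> close (f x) (f y)) ->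
  (forall x y, bnd (f x) (f y) -> bnd' x y) ->
  colorable N close bnd -> colorable N close' bnd'.
Proof.
move=> hc hb [Y [col [lab [h1 h2 h3]]]].
exists Y, (col \o f), (lab \o f); split=> //=.
- by move=> x x' e /hc; exact: h2.
- by move=> x x' e e'; apply: hb; exact: h3.
Qed.

Lemma metric_ge0 (R : realType) (X : Type) (d : X -> X -> R) (x y : X) :
  is_metric d -> 0 <= d x y.
Proof.
move=> [d0 dC dT]; have h := dT x y x; rewrite (dC y x) in h.
have : d x x = 0 by apply/d0.
lra.
Qed.

(** Finitely many finite balls cannot exhaust an infinite space, so points can be picked one at a
    time. They later make every family [D] nonempty. *)
Lemma separated_points (R : realType) (X : Type) (d : X -> X -> R) :
  (forall (x : X) (r : R), finite_set [set y | d x y <= r]) ->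
  infinite_set [set: X] ->
  forall (K : R) (n : nat), exists q : nat -> X,
    forall i j, (i < j <= n)%N -> K < d (q i) (q j).
Proof.
move=> fin inf K; elim=> [|n [q hq]].
  have [x _] : [set: X] !=set0.
    by apply/set0P; apply/eqP => e; apply: inf; rewrite e.
  by exists (fun=> x) => i j; lia.
have : infinite_set ([set: X] `\` \bigcup_(i in `I_n.+1) [set y | d (q i) y <= K]).
  apply: infinite_setD => //; apply: bigcup_finite; first exact: finite_II.
  by move=> i _; exact: fin.
move=> infD; have [x [_ hx]] :
    [set: X] `\` \bigcup_(i in `I_n.+1) [set y | d (q i) y <= K] !=set0.
  by apply/set0P; apply/eqP => e; apply: infD; rewrite e.
exists (fun i => if (i <= n)%N then q i else x) => i j /andP[ij jn].
have -> : (i <= n)%N by lia.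
case: ifP => jn'; first by apply: hq; lia.
rewrite ltNge; apply/negP => le; apply: hx; exists i => //=; lia.
Qed.

Lemma le_set_dist (R : realType) (X : Type) (d : X -> X -> R) (r : nat) (A B : set X) :
  (forall x y, A x -> B y -> r%:R <= d x y) -> ((r%:R : R)%:E <= set_dist d A B)%E.
Proof.
move=> h; apply: le_ereal_inf_tmp => _ [[x y] [/= Ax By] <-].
by rewrite lee_fin; exact: h.
Qed.

(* Merging the cells near a bounded set [Z] makes [Z] a part of a single cell
   in every color, at the price of a larger bound; the points of [Z] can then be
   added as singletons, far from all shells, to make the families nonempty. *)
Lemma colored_cells (R : realType) (X : Type) (d : X -> X -> R) (N : nat) (L M : R)
    (Z : set X) :
  is_metric d -> 0 <= L -> 0 <= M ->
  (forall x y, Z x -> Z y -> d x y <= M) ->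
  (exists B, colorable N (fun x y => d x y <= L) (fun x y => d x y <= B)) ->
  exists (Y : Type) (y0 : Y) (V : nat -> Y -> set X) (B : R),
  [/\ forall x, exists s y, (s < N)%N /\ V s y x,
      forall s y y' x x', V s y x -> V s y' x' -> d x x' <= L -> y = y',
      forall s y x x', V s y x -> V s y x' -> d x x' <= B
    & forall s, Z `<=` V s y0].
Proof.
move=> md L0 M0 bZ [B [Y [col [lab [h1 h2 h3]]]]].
have [d0 dC dT] := md.
pose near s y := exists x z, [/\ col x = s, lab x = y, Z z & d x z <= L].
pose V s (o : option Y) : set X := fun x =>
  if o is Some y then [/\ col x = s, lab x = y & ~ near s y]
  else Z x \/ col x = s /\ near s (lab x).
have [mB m0] : B <= Num.max B 0 /\ 0 <= Num.max B 0 by rewrite !le_max !lexx orbT.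
(* A cell that stays separate is farther than [L] from [Z] because it is not [near], and from the
   merged cells of its color because equal colors at distance at most [L] force equal labels. *)
have nearN s y x z : V s (Some y) x -> V s None z -> L < d x z.
  move=> [cx lx nn]; rewrite ltNge => -[Zz|[cz [w [u [cw lw Zu wu]]]]].
    by apply/negP => le; apply: nn; exists x, z.
  apply/negP => le; apply: nn.
  have e : lab x = lab z by apply: h2 => //; rewrite cx cz.
  by exists w, u; split => //; rewrite lw -e.
have VZ s x : V s None x -> exists2 z, Z z & d x z <= Num.max B 0 + L.
  move=> [Zx|[cx [w [u [cw lw Zu wu]]]]].
    by exists x => //; have -> : d x x = 0 by [apply/d0]; lra.
  exists u => //; have := h3 x w; rewrite cx cw lw => /(_ erefl erefl).
  have := dT x w u; lra.
exists (option Y), None, V, (M + (Num.max B 0 + L) + (Num.max B 0 + L)); split.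
- move=> x; exists (col x); have [hn|hn] := pselect (near (col x) (lab x)).
    by exists None; split=> //; right.
  by exists (Some (lab x)).
- move=> s [y|] [y'|] x x' Vx Vx' le //.
  + by move: Vx Vx' => [cx <- _] [cx' <- _]; congr Some; apply: h2; rewrite // cx.
  + by exfalso; have := nearN _ _ _ _ Vx Vx'; lra.
  + by exfalso; have := nearN _ _ _ _ Vx' Vx; rewrite dC; lra.
- move=> s [y|] x x' Vx Vx'.
    move: Vx Vx' => [cx lx _] [cx' lx' _].
    by have := h3 x x'; rewrite cx cx' lx lx' => /(_ erefl erefl); lra.
  have [z Zz xz] := VZ _ _ Vx; have [z' Zz' xz'] := VZ _ _ Vx'.
  have := bZ _ _ Zz Zz'; have := dT x z x'; have := dT z z' x'.
  rewrite (dC z' x'); lra.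
- by move=> s z Zz; left.
Qed.

(** * From finite asymptotic dimension to translated tilings *)

Definition thick (R : realType) (X : Type) (d : X -> X -> R) (r : R) (U : set X) : set X :=
  [set x | exists2 u, U u & d x u < r].

(** Only the first index carries shells; the families of index [i > 0] are single points [q (l i)],
    so that one construction serves every positive [m]. *)
Lemma DTUT_of_finite_asdim (R : realType) (X : Type) (d : X -> X -> R) (m : nat) :
  is_metric d ->
  (forall (x : X) (r : R), finite_set [set y | d x y <= r]) ->
  infinite_set [set: X] -> finite_asdim d -> DTUT d m.+1 0.
Proof.
move=> md fin inf [N hN]; have [d0 dC dT] := md.
(* [F] may depend on [X] only, and [N] does not depend on the scale. As [X] is nonempty, [N] is
   positive and the [N.-1.+1] indices enumerate the colors. *)
exists (fun=> N.-1) => h k h0 k0 kmono.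
pose K : R := (k ord_max)%:R.
pose H : nat := \sum_(i < m.+2) h (k i).
have K0 : 0 < K by rewrite ltr0n.
have kK i : (k i)%:R <= K.
  rewrite ler_nat; case: (ltnP i (@ord_max m.+1)) => [/kmono/ltnW //|le].
  by rewrite (_ : i = ord_max) //; apply/val_inj; move: le (ltn_ord i) => /=; lia.
have hH i : (h (k i) <= H)%N by rewrite /H (bigD1 i) //= leq_addr.
have [q hq] := separated_points fin inf K H.
have qK i j : (i <= H)%N -> (j <= H)%N -> i <> j -> K < d (q i) (q j).
  move=> iH jH; case: (ltngtP i j) => // ij _; first by apply: hq; lia.
  by rewrite dC; apply: hq; lia.
pose Z := [set q i | i in `I_H.+1].
have [M M0 bZ] : exists2 M : R, 0 <= M & forall x y, Z x -> Z y -> d x y <= M.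
  exists (\sum_(i < H.+1) \sum_(j < H.+1) d (q i) (q j)).
    by apply: sumr_ge0 => i _; apply: sumr_ge0 => j _; exact: metric_ge0.
  move=> _ _ [i /= iH <-] [j /= jH <-].
  rewrite (bigD1 (Ordinal iH)) //= (bigD1 (Ordinal jH)) //=.
  have a0 : 0 <= \sum_(i0 < H.+1 | i0 != Ordinal jH) d (q i) (q i0).
    by apply: sumr_ge0 => ? _; exact: metric_ge0.
  have : 0 <= \sum_(i0 < H.+1 | i0 != Ordinal iH) \sum_(j0 < H.+1) d (q i0) (q j0).
    by apply: sumr_ge0 => ? _; apply: sumr_ge0 => ? _; exact: metric_ge0.
  lra.
have HR0 : (0 : R) <= H%:R by rewrite ler0n.
(* Two cells thickened by at most [(2 * H + 1) * K] must still be [K] apart: twice this radius plus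
   [K]. *)
pose L : R := (4 * H%:R + 3) * K.
have L0 : 0 <= L by rewrite /L mulr_ge0 ?(ltW K0) //; lra.
have [Y [y0 [V [B [cov sep bnd Zin]]]]] := colored_cells md L0 M0 bZ (hN L).
have [mB m0] : B <= Num.max B 0 /\ 0 <= Num.max B 0 by rewrite !le_max !lexx orbT.
(* Shell [t] occupies the distances from [2tK] to [(2t + 1)K], which leaves a gap of width [K]
   before the next one. *)
pose rho (t : nat) : R := 2 * t%:R * K.
have rho_le t t' : (t <= t')%N -> rho t <= rho t'.
  by move=> tt'; rewrite /rho ler_wpM2r ?(ltW K0) // ler_wpM2l // ler_nat.
have rhoS t t' : (t < t')%N -> rho t + 2 * K <= rho t'.
  by move=> /rho_le; rewrite /rho -natr1; lra.
have rhoL t : (t <= H)%N -> rho t + rho H + 3 * K <= L.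
  by move=> /rho_le; rewrite /L /rho; lra.
pose shell s y t := thick d (rho t + K) (V s y) `\` thick d (rho t) (V s y).
have shell_bnd s y t x x' : shell s y t x -> shell s y t x' ->
    d x x' <= B + 2 * (rho t + K).
  move=> [[u Vu xu] _] [[u' Vu' xu'] _]; have := bnd _ _ _ _ Vu Vu'.
  by have := dT x u x'; have := dT u u' x'; rewrite (dC u' x'); lra.
have shell_cells s y y' t t' x x' : (t <= H)%N -> (t' <= H)%N ->
    shell s y t x -> shell s y' t' x' -> y <> y' -> K <= d x x'.
  move=> tH t'H [[u Vu xu] _] [[u' Vu' xu'] _] yy'.
  rewrite leNgt; apply/negP => lt; apply/yy'/(sep _ _ _ _ _ Vu Vu').
  have := dT u x u'; have := dT x x' u'; rewrite (dC u x).
  by have := rho_le _ _ tH; have := rhoL _ t'H; lra.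
have shell_layers s y t t' x x' : (t < t')%N ->
    shell s y t x -> shell s y t' x' -> K <= d x x'.
  move=> /rhoS tt' [[u Vu xu] _] [_ nx'].
  rewrite leNgt; apply/negP => lt; apply: nx'; exists u => //.
  by have := dT x' x u; rewrite (dC x' x); lra.
(* [q t] lies in the cell [y0] of every color, while shells with [t' > 0] start at distance [2 * K]
   from their cell; shells around other cells are kept away by [sep]. *)
have q_shell s y t t' x : (t <= H)%N -> (0 < t')%N -> (t' <= H)%N ->
    shell s y t' x -> K <= d (q t) x.
  move=> tH t'0 t'H [[u Vu xu] nx].
  have Vq : V s y0 (q t) by apply: Zin; exists t.
  rewrite leNgt; apply/negP => lt; apply: nx.
  have e : y0 = y.
    apply: sep Vq Vu _; have := dT (q t) x u; have := rho_le _ _ t'H.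
    by have := rhoL _ t'H; have := rho_le _ _ (leq0n H); rewrite {1}/rho mulr0 mul0r; lra.
  exists (q t); first by rewrite -e.
  by have := rhoS _ _ t'0; rewrite /rho mulr0 mul0r dC; lra.
have piece_sep s t t' A A' : (0 < t <= H)%N -> (0 < t' <= H)%N ->
    (exists y, A = shell s y t) \/ A = [set q t] ->
    (exists y, A' = shell s y t') \/ A' = [set q t'] ->
    t <> t' \/ A <> A' -> forall x x', A x -> A' x' -> K <= d x x'.
  move=> /andP[t0 tH] /andP[t'0 t'H] [[y ->]|->] [[y' ->]|->] ne x x'.
  - move=> sx sx'; have [yy'|yy'] := pselect (y = y'); last exact: shell_cells sx sx' yy'.
    subst y'; case: (ltngtP t t') => tt'.
    + exact: shell_layers tt' sx sx'.
    + by rewrite dC; exact: shell_layers tt' sx' sx.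
    + by subst t'; case: ne.
  - by move=> sx -> /=; rewrite dC; exact: q_shell sx.
  - by move=> -> /= sx; exact: q_shell sx.
  - move=> -> -> /=; apply/ltW/qK => //.
    by case: ne => // ne e; apply: ne; rewrite e.
(* Off the shells of [t], a point goes to the first color in which a thickened cell contains it. *)
pose core s y t := thick d (rho t) (V s y)
   `\` [set x | exists s' y', (s' < s)%N /\ thick d (rho t) (V s' y') x]
   `\` [set x | exists s' y', (s' < N)%N /\ shell s' y' t x].
pose C (l : 'I_m.+1 -> nat) (_ : 'I_1) : set (set X) :=
  [set A | exists s y, (s < N)%N /\ A = core s y (l ord0)].
pose D (l : 'I_m.+1 -> nat) (i : 'I_m.+1) (s : 'I_N.-1.+1) : set (set X) :=
  [set A | (i = ord0 /\ exists y, A = shell s y (l i)) \/ A = [set q (l i)]].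
have Dpiece l i s A : D l i s A ->
    (exists y, A = shell s y (l i)) \/ A = [set q (l i)].
  by move=> [[_ h1]|h1]; [left|right].
have tv l i : translation_vector h k l -> (0 < l i <= H)%N.
  by move=> /(_ i) /andP[l1 l2]; rewrite l1 (leq_trans l2).
(* A point of the later core avoids both the thickened cell of the earlier color and its shell, so
   it is at distance at least [rho t + K] from that cell. *)
have core_lt t s y s' y' x x' : (s < s' < N)%N ->
    core s y t x -> core s' y' t x' -> K <= d x x'.
  move=> /andP[ss' s'N] [[[u Vu xu] _] _] [[_ nlt] nsh].
  rewrite leNgt; apply/negP => lt.
  have nt : ~ thick d (rho t) (V s y) x' by move=> th; apply: nlt; exists s, y.
  apply: nsh; exists s, y; split; first by lia.
  split=> //; exists u => //.
  by have := dT x' x u; rewrite (dC x' x); lra.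
exists C, D; split=> l hl.
  split.
  - move=> j; split.
      exists (Num.max B 0 + 2 * rho (l ord0) + 1).
        by have := rho_le _ _ (leq0n (l ord0)); rewrite {1}/rho mulr0 mul0r; lra.
      move=> _ [s [y [_ ->]]] x x' [[[u Vu xu] _] _] [[[u' Vu' xu'] _] _].
      have := bnd _ _ _ _ Vu Vu'.
      by have := dT x u x'; have := dT u u' x'; rewrite (dC u' x'); lra.
    move=> _ _ [s [y [sN ->]]] [s' [y' [s'N ->]]] ne.
    apply: le_set_dist => x x' cx cx'; apply: le_trans (kK ord0) _.
    case: (ltngtP s s') => ss'.
    + by apply: core_lt cx cx'; rewrite ss'.
    + by rewrite dC; apply: core_lt cx' cx; rewrite ss'.
    + subst s'; have yy' : y <> y' by move=> yy'; apply: ne; rewrite yy'.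
      move: cx cx' => [[[u Vu xu] _] _] [[[u' Vu' xu'] _] _].
      rewrite leNgt; apply/negP => lt; apply/yy'/(sep _ _ _ _ _ Vu Vu').
      have /andP[_ lH] := tv l ord0 hl.
      have := dT u x u'; have := dT x x' u'; rewrite (dC u x).
      by have := rho_le _ _ lH; have := rhoL _ lH; lra.
  - move=> i s; split.
      exists (Num.max B 0 + 2 * (rho (l i) + K)).
        by have := rho_le _ _ (leq0n (l i)); rewrite {1}/rho mulr0 mul0r; lra.
      have r0 := rho_le _ _ (leq0n (l i)); rewrite {1}/rho mulr0 mul0r in r0.
      move=> A /Dpiece[[y ->]|->] x x'; last first.
        by move=> -> ->; have -> : d (q (l i)) (q (l i)) = 0 by [apply/d0]; lra.
      by move=> sx sx'; have := shell_bnd _ _ _ _ _ sx sx'; lra.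
    move=> A A' /Dpiece pA /Dpiece pA' ne.
    apply: le_set_dist => x x' Ax Ax'; apply: le_trans (kK _) _.
    by apply: piece_sep pA pA' _ _ _ Ax Ax'; [exact: tv|exact: tv|right].
  - move=> x.
    have [[s' [y' [s'N sh]]]|nsh] :=
        pselect (exists s' y', (s' < N)%N /\ shell s' y' (l ord0) x).
      right; exists ord0; have s'lt : (s' < N.-1.+1)%N by lia.
      by exists (Ordinal s'lt), (shell s' y' (l ord0)) => //; left; split=> //; exists y'.
    left; exists ord0.
    have ex : exists s, `[< (s < N)%N /\ exists y, thick d (rho (l ord0)) (V s y) x >].
      have [s [y [sN Vx]]] := cov x; exists s; apply/asboolP; split=> //; exists y.
      exists x => //; have -> : d x x = 0 by apply/d0.
      have /andP[l1 _] := tv l ord0 hl.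
      by have := rhoS _ _ l1; rewrite {1}/rho mulr0 mul0r; lra.
    case: (ex_minnP ex) => s /asboolP[sN [y th]] smin.
    exists (core s y (l ord0)); first by exists s, y.
    split=> //; split=> // -[s' [y' [lt th']]].
    have : (s <= s')%N by apply: smin; apply/asboolP; split; [lia|exists y'].
    lia.
move=> i s Dt hi.
have Dtpiece t A : Dt t A -> (exists y, A = shell s y t) \/ A = [set q t].
  by move=> /Dpiece; rewrite dfwithin.
have Dtq t : Dt t [set q t] by right; rewrite dfwithin.
have hiH t : (1 <= t <= hi)%N -> (0 < t <= H)%N.
  by move=> /andP[-> /leq_trans]; apply; exact: hH.
split.
  move=> t t' t1 tt' t'h; have tH : (0 < t <= H)%N by apply: hiH; lia.
  have t'H : (0 < t' <= H)%N by apply: hiH; lia.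
  split; [by exists (q t), [set q t]|by exists (q t'), [set q t']|].
  apply/seteqP; split=> // x [[A /Dtpiece pA Ax] [A' /Dtpiece pA' A'x]].
  have tnt' : t <> t' by lia.
  have := piece_sep _ _ _ _ _ tH t'H pA pA' (or_introl tnt') _ _ Ax A'x.
  by have -> : d x x = 0 by [apply/d0]; lra.
move=> A A' [t /= th /Dtpiece pA] [t' /= t'h /Dtpiece pA'] ne.
apply: le_set_dist => x x' Ax Ax'; apply: le_trans (kK _) _.
by apply: piece_sep pA pA' _ _ _ Ax Ax'; [exact: hiH|exact: hiH|right].
Qed.

(** With [m = 0] there are no families [D], and the whole space is one cell; the sum of all
    distances, plus one for positivity, bounds its diameter. *)
Lemma DTUT_of_finite (R : realType) (X : choiceType) (d : X -> X -> R) :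
  is_metric d -> finite_set [set: X] -> DTUT d 0 0.
Proof.
move=> md fX; exists (fun=> 0) => h k _ _ _.
exists (fun _ _ => [set [set: X]]), (fun _ _ _ => set0).
split=> [l _|l _ []//]; split=> [j|[]//|x]; last by left; exists ord0, setT.
split; last by move=> _ _ -> ->.
have [s es] := (finite_seqP [set: X]).1 fX.
have mem x : x \in s by have : [set: X] x by []; rewrite es.
have d0 x y : 0 <= d x y by exact: metric_ge0.
exists (1 + \sum_(a <- s) \sum_(b <- s) d a b).
  by rewrite ltr_wpDr //; apply: sumr_ge0 => a _; apply: sumr_ge0.
move=> _ -> x y _ _; rewrite (big_rem x) //= (big_rem y (mem y)) /=.
have : 0 <= \sum_(b <- rem y s) d x b by apply: sumr_ge0.
have : 0 <= \sum_(a <- rem x s) \sum_(b <- s) d a b.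
  by apply: sumr_ge0 => a _; apply: sumr_ge0.
lra.
Qed.

(** * Maximal independent sets and greedy colorings *)

Lemma maximal_independent (T : Type) (E : T -> T -> Prop) (B : set T) :
  (forall x, E x x) -> (forall x y, E x y -> E y x) ->
  exists I : set T, [/\ I `<=` B, forall x y, I x -> I y -> E x y -> x = y
    & forall x, B x -> exists2 y, I y & E x y].
Proof.
move=> Er Es.
pose P (I : set T) := I `<=` B /\ forall x y, I x -> I y -> E x y -> x = y.
have [|I [[IB Ii] Imax]] := @Zorn_bigcup T P.
- move=> F FP Ft; split=> [x [X /FP[XB _] Xx]|]; first exact: XB.
  move=> x y [X FX Xx] [X' FX' Xy].
  have [XX'|X'X] := Ft _ _ FX FX'.
    by have [_ h] := FP _ FX'; apply: h => //; apply: XX'.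
  by have [_ h] := FP _ FX; apply: h => //; apply: X'X.
exists I; split=> // x Bx; apply: contrapT => nx.
have nI : ~ I x by move=> Ix; apply: nx; exists x.
apply: (Imax (I `|` [set x])).
  by split=> [|sub]; [exact: subsetUl|apply: nI; apply: sub; right].
split=> [y [/IB|->]//|y z [Iy|->] [Iz|->] //] Eyz; first exact: Ii.
- by case: nx; exists y => //; exact: Es.
- by case: nx; exists z.
Qed.

(* Iterating maximal independent sets colors a graph greedily. *)
Lemma bounded_degree_coloring (T : choiceType) (E : T -> T -> Prop) (A : set T) (C : nat) :
  (forall x, E x x) -> (forall x y, E x y -> E y x) ->
  (forall p (s : seq T), uniq s -> (forall q, q \in s -> A q /\ E p q) ->
     (size s <= C)%N) ->
  exists col : T -> nat, (forall p, A p -> (col p < C)%N) /\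
    forall p q, A p -> A q -> col p = col q -> E p q -> p = q.
Proof.
move=> Er Es deg.
have [I hI] := choice (fun B => maximal_independent B Er Es).
pose rem := fix rem n := if n is n'.+1 then rem n' `\` I (rem n') else A.
have remS m n : (m <= n)%N -> rem n `<=` rem m.
  elim: n => [|n IHn]; first by rewrite leqn0 => /eqP ->.
  by rewrite leq_eqVlt => /predU1P[->//|/IHn h] x /= [/h].
have colored p : A p -> exists2 n, (n < C)%N & I (rem n) p.
  move=> Ap; apply: contrapT => no.
  have inrem n : (n <= C)%N -> rem n p.
    elim: n => [//|n IHn] nC /=; split; first by apply: IHn; lia.
    by move=> Ip; apply: no; exists n.
  (* A point left after [C] rounds would have, for each [n] from [0] to [C], a neighbor [q n] in the
     set removed at round [n]. These [C + 1] neighbors are distinct, against the degree bound. *)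
  have /choice[q hq] : forall n, exists q, (n <= C)%N -> I (rem n) q /\ E p q.
    move=> n; case: (leqP n C) => [nC|]; last by exists p.
    by have [_ _ /(_ _ (inrem n nC))[q]] := hI (rem n); exists q.
  have qrem n : (n <= C)%N -> rem n (q n).
    by move=> /hq[Iq _]; have [sub _ _] := hI (rem n); exact: sub.
  have qinj m n : (m < n <= C)%N -> q m <> q n.
    move=> /andP[mn nC] e; have := remS _ _ mn _ (qrem n nC).
    move=> /= [_]; apply; rewrite -e.
    by have [|] := hq m; first by lia.
  have : (size [seq q i | i <- iota 0 C.+1] <= C)%N.
    apply: (deg p) => [|r /mapP[i]].
      rewrite map_inj_in_uniq ?iota_uniq // => i j; rewrite !mem_iota => hi hj e.
      by case: (ltngtP i j) => // ij; [case: (qinj i j)|case: (qinj j i)] => //; lia.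
    rewrite mem_iota => hi ->; have iC : (i <= C)%N by lia.
    split; last by have [] := hq i iC.
    exact: (remS 0%N i (leq0n i) _ (qrem i iC)).
  by rewrite size_map size_iota ltnn.
have /choice[col hcol] : forall p, exists n, A p -> (n < C)%N /\ I (rem n) p.
  by move=> p; have [/colored[n]|nA] := pselect (A p); [exists n|exists 0%N].
exists col; split=> [p /hcol[]//|p q Ap Aq e Epq].
have [_ Ip] := hcol _ Ap; have [_ Iq] := hcol _ Aq.
by have [_ ind _] := hI (rem (col p)); apply: ind => //; rewrite e.
Qed.

Lemma finite_set_bounded (T : choiceType) (A : set T) (f : T -> nat) :
  finite_set A -> exists M, forall x, A x -> (f x <= M)%N.
Proof.
move=> /finite_seqP[s ->]; exists (\max_(x <- s) f x)%N => x /= xs.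
by rewrite (leq_bigmax_seq x).
Qed.

(** * Graph distances *)

(** On a connected graph the infimum in [graph_dist] is attained, so distances can be handled as
    natural numbers. *)
Definition is_gdist (T : Type) (E : T -> T -> Prop) (g : T -> T -> nat) : Prop :=
  (forall x y, walk E (g x y) x y) /\
  (forall n x y, walk E n x y -> (g x y <= n)%N).

Lemma walk_cat (T : Type) (E : T -> T -> Prop) m n x y z :
  walk E m x y -> walk E n y z -> walk E (m + n) x z.
Proof.
elim: m x => [x -> //|m IHm x [u xu uy] yz] /=.
by exists u => //; exact: IHm.
Qed.

Lemma walk_split (T : Type) (E : T -> T -> Prop) m n x z :
  walk E (m + n) x z -> exists2 y, walk E m x y & walk E n y z.
Proof.
elim: m x => [x h|m IHm x [u xu /IHm[y uy yz]]]; first by exists x.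
by exists y => //; exists u.
Qed.

Lemma walk_sym (T : Type) (E : T -> T -> Prop) n x y :
  (forall x y, E x y -> E y x) -> walk E n x y -> walk E n y x.
Proof.
move=> Es; elim: n x => [x -> //|n IHn x [u xu uy]].
rewrite -addn1; apply: (walk_cat (y := u)); first exact: IHn.
by exists x => //; exact: Es.
Qed.

Section GraphDistance.
Variables (T : Type) (E : T -> T -> Prop) (g : T -> T -> nat).
Hypotheses (Es : forall x y, E x y -> E y x) (hg : is_gdist E g).

Lemma gdist_sym x y : g x y = g y x.
Proof.
have [h1 h2] := hg; apply/eqP; rewrite eqn_leq.
by rewrite !h2 //; apply: walk_sym => //; exact: h1.
Qed.

Lemma gdist_refl x : g x x = 0%N.
Proof. by apply/eqP; rewrite -leqn0; apply: hg.2. Qed.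

Lemma gdist_triangle x y z : (g x z <= g x y + g y z)%N.
Proof. by apply: hg.2; apply: (walk_cat (y := y)); exact: hg.1. Qed.

Lemma gdist_eq0 x y : g x y = 0%N -> x = y.
Proof. by move=> e; have := hg.1 x y; rewrite e. Qed.

Lemma gdist_between x y a : (a <= g x y)%N ->
  exists2 z, g x z = a & (g x z + g z y)%N = g x y.
Proof.
move=> le; have w := hg.1 x y; rewrite -[X in walk E X](subnKC le) in w.
have [z w1 w2] := walk_split w.
have h1 := hg.2 _ _ _ w1; have h2 := hg.2 _ _ _ w2.
by exists z; have := gdist_triangle x z y; lia.
Qed.

End GraphDistance.

Lemma exists_gdist (T : Type) (E : T -> T -> Prop) :
  (forall x y, exists n, walk E n x y) -> exists g, is_gdist E g.
Proof.
move=> conn.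
have /choice[g0 hg0] : forall p : T * T, exists n,
    walk E n p.1 p.2 /\ forall m, walk E m p.1 p.2 -> (n <= m)%N.
  move=> [x y] /=; have ex : exists n, `[< walk E n x y >].
    by have [n w] := conn x y; exists n; apply/asboolP.
  case: (ex_minnP ex) => n /asboolP w nmin; exists n; split=> // m wm.
  by apply: nmin; apply/asboolP.
exists (fun x y => g0 (x, y)).
by split=> [x y|n x y]; have [h1 h2] := hg0 (x, y) => //; exact: h2.
Qed.

Lemma graph_distE (R : realType) (T : Type) (E : T -> T -> Prop) g x y :
  is_gdist E g -> graph_dist R E x y = (g x y)%:R.
Proof.
move=> [h1 h2]; apply/le_anti/andP; split.
  by apply: ge_inf; [exists 0 => _ [n _ <-]; rewrite ler0n|exists (g x y)].
apply: lb_le_inf; first by exists ((g x y)%:R), (g x y).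
by move=> _ [n /h2 le <-]; rewrite ler_nat.
Qed.

(** * The four-point inequality and coloring by annuli *)

Definition four_point (T : Type) (g : T -> T -> nat) (D : nat) : Prop :=
  forall w x y z, (g x z + g y w <= maxn (g x y + g z w) (g y z + g x w) + D)%N.

(** Doubling the inequality of Gromov products cancels one distance to the base point. [D] bounds
    [2 * delta], through the absolute value as [delta] may be negative. *)
Lemma hyperbolic_four_point (R : realType) (T : Type) (d : T -> T -> R)
    (g : T -> T -> nat) :
  (forall x y, d x y = (g x y)%:R) -> gromov_hyperbolic d ->
  exists D, four_point g D.
Proof.
move=> dg [delta hyp]; exists (Num.bound `|2 * delta|) => w x y z.
have hb : 2 * delta <= (Num.bound `|2 * delta|)%:R.
  by apply: le_trans (ler_norm _) _; apply: ltW; apply: archi_boundP.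
have := hyp w x y z; rewrite /gromov_product !dg lerBlDr ge_min => /orP h.
rewrite -(ler_nat R) natrD [_%:R in leRHS]natrD.
have [m1 m2] : ((g x y + g z w)%N%:R : R) <= (maxn (g x y + g z w) (g y z + g x w))%:R
    /\ ((g y z + g x w)%N%:R : R) <= (maxn (g x y + g z w) (g y z + g x w))%:R.
  by rewrite !ler_nat leq_maxl leq_maxr.
by move: m1 m2; rewrite !natrD; case: h => h; lra.
Qed.

(* A point [x] at distance about [k * L] from the base point is sent to a point
   [y] at distance [(k - 1) * L] on a geodesic to [x].  By hyperbolicity, points
   [x], [x'] of one annulus at distance at most [L] have [y], [y'] within [2 * D],
   whatever [L], so that one coloring at scale [2 * D] serves all scales. *)
Lemma hyperbolic_colorable (T : Type) (E : T -> T -> Prop) (g : T -> T -> nat)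
    (D N B : nat) (e : T) :
  (forall x y, E x y -> E y x) -> is_gdist E g -> four_point g D ->
  colorable N (fun x y => (g x y <= 2 * D)%N) (fun x y => (g x y <= B)%N) ->
  forall L, exists B',
    colorable (2 * N) (fun x y => (g x y <= L)%N) (fun x y => (g x y <= B')%N).
Proof.
move=> Es hg hyp [Y [col [lab [h1 h2 h3]]]] L.
have gC := gdist_sym Es hg; have gT := gdist_triangle hg.
(* [M > L] puts distinct annuli of the same parity more than [L] apart. *)
pose M := L.+1; pose k x := (g e x %/ M)%N.
have hk x : (k x * M <= g e x < (k x).+1 * M)%N.
  by rewrite leq_trunc_div /=; apply: ltn_ceil.
have /choice[y hy] : forall x, exists y,
    g e y = ((k x).-1 * M)%N /\ (g e y + g y x)%N = g e x.
  move=> x; have [|z] := @gdist_between _ _ _ hg e x ((k x).-1 * M)%N.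
    by apply: leq_trans (andP (hk x)).1; rewrite leq_mul2r leq_pred orbT.
  by move=> <- ?; exists z.
have yM x : (g (y x) x <= 2 * M)%N.
  have [ey] := hy x; have /andP[_] := hk x; rewrite ey.
  by case: (k x) => [|n] /=; lia.
have hyp_y x x' : k x = k x' -> (g x x' <= L)%N -> (g (y x) (y x') <= 2 * D)%N.
  move=> ek le; have [e1 e2] := hy x; have [e1' e2'] := hy x'.
  have /andP[l1 _] := hk x; have /andP[l1' _] := hk x'.
  case E0 : (k x) => [|n].
    have z0 : g e (y x) = 0%N by rewrite e1 E0.
    have z0' : g e (y x') = 0%N by rewrite e1' -ek E0.
    by rewrite -(gdist_eq0 hg z0) -(gdist_eq0 hg z0') (gdist_refl hg).
  rewrite -ek in e1' l1'; rewrite E0 /= in e1 e1' l1 l1'.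
  have p1 := hyp e (y x) x x'; have p2 := hyp e (y x) x' (y x').
  rewrite (gC x e) (gC x' e) (gC (y x) e) in p1.
  rewrite (gC (y x') e) (gC x' e) (gC (y x) e) (gC x' (y x')) in p2.
  have L' : (L < M)%N by [].
  rewrite mulSn in l1 l1'.
  move: p1 p2; rewrite /maxn; do 2 case: ifP; lia.
(* The low bit of the color is the parity of the annulus. Each point is within [2 * M] of its
   projection, whence the bound. *)
exists (4 * M + B)%N, (nat * Y)%type, (fun x => (col (y x)).*2 + odd (k x))%N,
  (fun x => (k x, lab (y x))); split.
- by move=> x; have := h1 (y x); case: odd; lia.
- move=> x x' ec le.
  have ec' : col (y x) = col (y x').
    by have := congr1 half ec; rewrite !(addnC _.*2) !half_bit_double.
  have eo : odd (k x) = odd (k x').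
    by have := congr1 odd ec; rewrite !oddD !odd_double !oddb.
  have ek : k x = k x'.
    have := hk x; have := hk x'; have := gT e x x'; have := gT e x' x.
    rewrite (gC x' x) => t1 t2 /andP[a1 a2] /andP[b1 b2].
    have c1 : (k x' * M < (k x).+2 * M)%N.
      by rewrite mulSn; apply: leq_ltn_trans a1 _; rewrite /M in b2 *; lia.
    have c2 : (k x * M < (k x').+2 * M)%N.
      by rewrite mulSn; apply: leq_ltn_trans b1 _; rewrite /M in a2 *; lia.
    rewrite !ltn_mul2r /= in c1 c2; lia.
  by congr pair => //; apply: h2 => //; exact: hyp_y.
- move=> x x' ec [ek el].
  have ec' : col (y x) = col (y x').
    by have := congr1 half ec; rewrite !(addnC _.*2) !half_bit_double.
  have := h3 _ _ ec' el; have := yM x; have := yM x'.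
  have := gT x (y x) x'; have := gT (y x) (y x') x'; rewrite (gC x (y x)); lia.
Qed.

(** * Cayley graphs and word metrics *)

Lemma cayley_sym (G : groupType) (S : set G) x y : cayley S x y -> cayley S y x.
Proof. by move=> [s Ss [h|h]]; exists s => //; [right|left]. Qed.

Lemma walk_cayleyM (G : groupType) (S : set G) n z x y :
  walk (cayley S) n x y -> walk (cayley S) n (z * x)%g (z * y)%g.
Proof.
elim: n x => [x -> //|n IHn x [u [s Ss h] uy]].
exists (z * u)%g; last exact: IHn.
by exists s => //; case: h => ->; [left|right]; rewrite mulgA.
Qed.

Lemma walk_cayley_subset (G : groupType) (S S' : set G) n x y : S `<=` S' ->
  walk (cayley S) n x y -> walk (cayley S') n x y.
Proof.
move=> SS'; elim: n x => [//|n IHn x [u [s Ss h] uy]].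
by exists u; [exists s => //; exact: SS'|exact: IHn].
Qed.

Lemma walk_generated (G : groupType) (S : set G) x y :
  generated S (x^-1 * y)%g -> exists n, walk (cayley S) n x y.
Proof.
move=> gen; have : exists n, walk (cayley S) n 1%g (x^-1 * y)%g.
  apply: (gen [set g | exists n, walk (cayley S) n 1%g g]); split.
    split=> /= [|a b [m wa] [n wb]|a [m wa]]; first by exists 0%N.
      exists (m + n)%N; apply: (walk_cat wa).
      by rewrite -{1}[a]mulg1; exact: walk_cayleyM.
    exists m; rewrite -[1%g](mulVg a) -{2}[(a^-1)%g]mulg1; apply: walk_cayleyM.
    by apply: walk_sym => //; exact: cayley_sym.
  move=> s Ss; exists 1%N; exists s => //; exists s => //; left.
  by rewrite mul1g.
by move=> [n w]; exists n; rewrite -[x]mulg1 -[y](mulVKg x); exact: walk_cayleyM.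
Qed.

Section CayleyDistance.
Variables (G : groupType) (S : set G) (g : G -> G -> nat).
Hypothesis hg : is_gdist (cayley S) g.

Lemma gdist_mull z x y : g (z * x)%g (z * y)%g = g x y.
Proof.
apply/eqP; rewrite eqn_leq; apply/andP; split.
  by apply: hg.2; apply: walk_cayleyM; exact: hg.1.
apply: hg.2; rewrite -{2}[x](mulKg z) -{2}[y](mulKg z).
by apply: walk_cayleyM; exact: hg.1.
Qed.

Lemma gdist1 x y : g x y = g 1%g (x^-1 * y)%g.
Proof. by rewrite -(gdist_mull x^-1) mulVg. Qed.

Lemma word_ballP n x : word_ball S n x <-> (g 1%g x <= n)%N.
Proof.
split=> [[j jn /hg.2 le]|le]; first exact: leq_trans le jn.
by exists (g 1%g x) => //; exact: hg.1.
Qed.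

Variables (R : realType) (d : G -> G -> R).
Hypotheses (hd : proper_left_invariant_metric d) (finS : finite_set S).

Lemma metric_le_word (n : nat) :
  exists B : R, forall x y, (g x y <= n)%N -> d x y <= B.
Proof.
have [md dM _] := hd; have [d0 dC dT] := md.
have [s es] := (finite_seqP S).1 finS.
pose M := \sum_(a <- s) d 1%g a.
have sM a : S a -> d 1%g a <= M.
  rewrite es /= => sa; rewrite /M (big_rem a) //= lerDl.
  by apply: sumr_ge0 => b _; exact: metric_ge0.
have M0 : 0 <= M by apply: sumr_ge0 => b _; exact: metric_ge0.
have wM m x y : walk (cayley S) m x y -> d x y <= m%:R * M.
  elim: m x => [x ->|m IHm x [u [a Sa h] /IHm le]].
    by rewrite mul0r; have -> : d y y = 0 by apply/d0.
  have xu : d x u <= M.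
    case: h => ->; first by rewrite -{1}[x]mulg1 dM; exact: sM.
    by rewrite dC -{1}[u]mulg1 dM; exact: sM.
  by have := dT x u y; rewrite -natr1; lra.
exists (n%:R * M) => x y le; apply: le_trans (wM _ _ _ (hg.1 x y)) _.
by apply: ler_wpM2r => //; rewrite ler_nat.
Qed.

(** By left invariance only the [d]-ball around [1] matters, and it is finite. With [metric_le_word]
    this makes [d] coarsely equivalent to the word metric. *)
Lemma word_le_metric (L : R) :
  exists n : nat, forall x y, d x y <= L -> (g x y <= n)%N.
Proof.
have [_ dM fin] := hd.
have [n hn] := finite_set_bounded (g 1%g) (fin 1%g L).
exists n => x y le; rewrite gdist1; apply: hn => /=.
by rewrite -(dM x) mulg1 mulVKg.
Qed.

Lemma finite_asdim_of_word N :
  (forall L : nat, exists B : nat,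
    colorable N (fun x y => (g x y <= L)%N) (fun x y => (g x y <= B)%N)) ->
  finite_asdim d.
Proof.
move=> h; exists N => L; have [n hn] := word_le_metric L.
have [m hm] := h n; have [B hB] := metric_le_word m; exists B.
by apply: (@colorable_pullback _ _ id) hm => x y; [exact: hn|exact: hB].
Qed.

Lemma finite_word_ball n : finite_set (word_ball S n).
Proof.
have [_ _ fin] := hd; have [B hB] := metric_le_word n.
by apply: sub_finite_set (fin 1%g B) => x /word_ballP; exact: hB.
Qed.

End CayleyDistance.

Lemma gdist_cayley (G : groupType) (S : set G) : generated S = setT ->
  exists g, is_gdist (cayley S) g.
Proof.
by move=> gen; apply: exists_gdist => x y; apply: walk_generated; rewrite gen.
Qed.

(** * Polynomial growth *)

(** If every step from [r] to [8 * r] beyond [r0] multiplied [V] by more than [8 ^ D.+1], then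
    [V (8 ^ j * s)] would be at least [8 ^ (D.+1 * j)]. The polynomial bound is [j * 8 ^ (D * j)]
    for [j = c * (2 * s) ^ D], and [j < 8 ^ j]. *)
Lemma doubling_scale (V : nat -> nat) c D :
  (forall n, (0 < V n)%N) -> (forall n, (V n <= c * n.+1 ^ D)%N) ->
  exists C, forall r0, exists2 r, (r0 <= r)%N & (V (8 * r) <= C * V r)%N.
Proof.
move=> V0 hV; exists (8 ^ D.+1)%N => r0; apply: contrapT => no.
pose s := r0.+1; pose r j := (8 ^ j * s)%N.
have lt j : (8 ^ D.+1 * V (r j) < V (r j.+1))%N.
  rewrite ltnNge; apply/negP => le; apply: no; exists (r j).
    have e0 : (0 < 8 ^ j)%N by rewrite expn_gt0.
    by rewrite /r /s; nia.
  by move: le; rewrite /r expnS mulnA.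
have low j : (8 ^ (D.+1 * j) <= V (r j))%N.
  elim: j => [|j IHj]; first by rewrite muln0 V0.
  apply: leq_trans (ltnW (lt j)); rewrite mulnS expnD.
  by rewrite leq_mul2l IHj orbT.
pose j := (c * (2 * s) ^ D)%N.
have up : (V (r j) <= j * 8 ^ (D * j))%N.
  apply: leq_trans (hV _) _; rewrite /j -mulnA leq_mul2l; apply/orP; right.
  rewrite [(D * j)%N]mulnC expnM -expnMn.
  case: (posnP D) => [->//|D0]; rewrite leq_exp2r // /r /s.
  have : (0 < 8 ^ j * r0.+1)%N by rewrite muln_gt0 expn_gt0.
  by rewrite -mulnA [(r0.+1 * _)%N]mulnC; move: (_ * _)%N; lia.
have := leq_trans (low j) up; rewrite mulSn expnD leq_mul2r.
by rewrite expn_eq0 /= leqNgt ltn_expl.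
Qed.

(** At a doubling scale [r >= L], at most [C] points of a [2 * r]-separated net lie within [5 * r]
    of a given point, so [C] colors suffice whatever [L]. A point takes the color of a net point
    within [2 * r]; points at distance at most [L] have net points within
    [2 * r + L + 2 * r <= 5 * r]. *)
Lemma finite_asdim_of_growth (R : realType) (G : groupType) (d : G -> G -> R)
    (S : set G) (c D : nat) :
  proper_left_invariant_metric d -> finite_generating setT S ->
  (forall n, exists2 s : seq G, (size s <= c * n.+1 ^ D)%N &
     forall x, word_ball S n x -> x \in s) ->
  finite_asdim d.
Proof.
move=> hd [finS genS] grow; have [g hg] := gdist_cayley genS.
have gC := gdist_sym (@cayley_sym G S) hg; have gT := gdist_triangle hg.
have /choice[b hb] : forall n, exists s : seq G,
    uniq s /\ forall x, (x \in s) = (g 1%g x <= n)%N.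
  move=> n; have [s es] := (finite_seqP _).1 (finite_word_ball hg hd finS n).
  exists (undup s); split=> [|x]; first exact: undup_uniq.
  have h := word_ballP hg n x; rewrite es /= in h.
  by rewrite mem_undup; apply/idP/idP => /h.
have [C hC] : exists C, forall r0, exists2 r, (r0 <= r)%N &
    (size (b (8 * r)) <= C * size (b r))%N.
  apply: (@doubling_scale _ c D) => n; have [un bn] := hb n.
    have : 1%g \in b n by rewrite bn (gdist_refl hg).
    by case: (b n).
  have [s ss hs] := grow n; apply: leq_trans ss.
  apply: uniq_leq_size un _ => x; rewrite bn => /(word_ballP hg n x); exact: hs.
apply: (finite_asdim_of_word hg hd finS (N := C)) => L.
have [r Lr dbl] := hC L.
have refl n x : (g x x <= n)%N by rewrite (gdist_refl hg).
have sym n x y : (g x y <= n)%N -> (g y x <= n)%N by rewrite gC.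
have gq q x : g q (q * x)%g = g 1%g x by rewrite -{1}[q]mulg1 (gdist_mull hg).
have [A [_ Asep Anet]] := @maximal_independent G (fun x y => (g x y <= 2 * r)%N) setT
  (refl _) (sym _).
have [col [colC colE]] : exists col : G -> nat, (forall p, A p -> (col p < C)%N) /\
    forall p q, A p -> A q -> col p = col q -> (g p q <= 5 * r)%N -> p = q.
  apply: bounded_degree_coloring (refl _) (sym _) _ => p s us hs.
  have [ur br] := hb r; have [u8 b8] := hb (8 * r)%N.
  have r0 : (0 < size (b r))%N.
    have : 1%g \in b r by rewrite br.
    by case: (b r).
  rewrite -(leq_pmul2r r0) (leq_trans _ dbl) // -(size_allpairs (fun q x => (p^-1 * (q * x))%g)).
  (* The balls of radius [r] around the points of [s] are disjoint and lie in
     the ball of radius [6 * r] around [p]. *)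
  apply: uniq_leq_size.
    apply: allpairs_uniq => // -[q x] [q' x'] /=.
    move=> /allpairsP[[q1 x1] /= [q1s x1b [-> ->]]].
    move=> /allpairsP[[q2 x2] /= [q2s x2b [-> ->]]] /mulgI e.
    have e12 : q1 = q2.
      have [Aq1 _] := hs _ q1s; have [Aq2 _] := hs _ q2s.
      apply: Asep => //; have := gT q1 (q1 * x1)%g q2.
      rewrite {2}e (gC (q2 * x2)%g) !gq.
      by move: x1b x2b; rewrite !br; lia.
    by subst q2; move/mulgI: e => ->.
  move=> _ /allpairsP[[q x] /= [qs xb ->]]; rewrite b8 -(gdist1 hg).
  have [_ pq] := hs _ qs; have := gT p q (q * x)%g.
  rewrite gq => /leq_trans; apply; rewrite br in xb.
  by apply: leq_trans (leq_add pq xb) _; lia.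
have /choice[p hp] : forall x, exists p, A p /\ (g x p <= 2 * r)%N.
  by move=> x; have [p Ap xp] := Anet x I; exists p.
exists (4 * r)%N, G, (col \o p), p; split=> [x|x y e le|x y _ e] /=.
- by apply: colC; have [] := hp x.
- have [Ax xp] := hp x; have [Ay yp] := hp y; apply: colE => //.
  have := gT (p x) x (p y); have := gT x y (p y); rewrite (gC (p x) x); lia.
- have [_ xp] := hp x; have [_ yp] := hp y.
  have := gT x (p x) y; rewrite {2}e (gC (p y) y); lia.
Qed.

Lemma finite_asdim_of_polynomial_growth (R : realType) (G : groupType) (d : G -> G -> R) :
  proper_left_invariant_metric d -> polynomial_growth G -> finite_asdim d.
Proof.
move=> hd [S [genS [c [D grow]]]].
apply: (finite_asdim_of_growth (c := (c * 2 ^ D)%N) (D := D) hd genS) => n.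
have fin : finite_set (word_ball S n.+1).
  by apply: card_le_finite (grow n.+1 _) (finite_II _).
exists (finmap.enum_fset (fset_set (word_ball S n.+1))) => [|x [j jn w]].
  apply: leq_trans (geq_card_fset_set (grow n.+1 isT)) _.
  rewrite -mulnA leq_mul2l -expnMn; case: (posnP D) => [->|D0]; first by rewrite orbT.
  by rewrite leq_exp2r // mul2n -addnn; lia.
apply: (etrans (in_fset_set fin x)); apply: mem_set.
by exists j => //; lia.
Qed.

(** * Growth of nilpotent groups *)

Section WordBalls.
Variables (G : groupType) (S : set G).

Lemma word_ball1 n : word_ball S n 1%g.
Proof. by exists 0%N. Qed.

Lemma word_ballW m n x : (m <= n)%N -> word_ball S m x -> word_ball S n x.
Proof. by move=> mn [j jm w]; exists j => //; exact: leq_trans mn. Qed.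

Lemma word_ballM m n x y :
  word_ball S m x -> word_ball S n y -> word_ball S (m + n) (x * y)%g.
Proof.
move=> [i im wx] [j jn wy]; exists (i + j)%N; first exact: leq_add.
by apply: (walk_cat wx); rewrite -{1}[x]mulg1; exact: walk_cayleyM.
Qed.

Lemma word_ballV n x : word_ball S n x -> word_ball S n x^-1%g.
Proof.
move=> [j jn w]; exists j => //; rewrite -(mulVg x) -{2}[(x^-1)%g]mulg1.
by apply: walk_cayleyM; apply: walk_sym => //; exact: cayley_sym.
Qed.

Lemma word_ball_gen x : S x -> word_ball S 1 x.
Proof. by move=> Sx; exists 1%N => //; exists x => //; exists x => //; left; rewrite mul1g. Qed.

Lemma word_ballS n x : word_ball S n.+1 x -> word_ball S n x \/
  exists z y, [/\ S z \/ S z^-1%g, word_ball S n y & x = (z * y)%g].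
Proof.
move=> [[|j] jn w]; first by left; rewrite -(w : 1%g = x); exact: word_ball1.
case: w => z [s Ss h] w; right; exists z, (z^-1 * x)%g; split.
- case: h => h; first by left; rewrite h mul1g.
  by right; rewrite (_ : (z^-1)%g = s) //; apply: (mulgI z); rewrite mulgV.
- by exists j => //; rewrite -(mulVg z); exact: walk_cayleyM.
- by rewrite mulVKg.
Qed.

End WordBalls.

Lemma word_ball_subset (G : groupType) (S S' : set G) n :
  S `<=` S' -> word_ball S n `<=` word_ball S' n.
Proof. by move=> SS' x [j jn w]; exists j => //; exact: walk_cayley_subset w. Qed.

Lemma word_ball_conj (G : groupType) (S S' : set G) q y :
  (forall x, S x -> word_ball S' q (x ^ y)%g) ->
  forall n x, word_ball S n x -> word_ball S' (n * q) (x ^ y)%g.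
Proof.
move=> h; elim=> [|n IHn] x.
  move=> [j]; rewrite leqn0 => /eqP -> e; rewrite -(e : 1%g = x) conj1g.
  exact: word_ball1.
case/word_ballS => [/IHn|[z [u [Sz /IHn hu ->]]]].
  by apply: word_ballW; rewrite leq_mul2r leqnSn orbT.
rewrite mulSn conjMg; apply: word_ballM hu.
case: Sz => [/h//|/h/word_ballV]; by rewrite conjVg invgK.
Qed.

(** The left-normed commutator [[x, t, ..., t]] with [j] entries [t]. *)
Definition iter_comm (G : groupType) (t x : G) (j : nat) : G :=
  iter j (fun z => [~ z, t]%g) x.

Lemma leq_expSn a k : (a ^ k <= a.+1 ^ k)%N.
Proof. by case: k => // k; rewrite leq_exp2r. Qed.

Section Collection.
Variables (G : groupType) (t x : G) (S : set G) (M : nat).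
Hypotheses (S_comm : forall j, S (iter_comm t x j)) (comm_M : iter_comm t x M = 1%g).
Local Notation c := (iter_comm t x).

Let conj_c j : (c j ^ t = c j * c j.+1)%g.
Proof. by rewrite /iter_comm iterS commgEl mulVKg. Qed.

(** As [c j ^ t = c j * c j.+1], the lengths obey the recursion of Pascal's triangle; [k] counts the
    commutator steps left before [c M = 1]. *)
Lemma conj_pos_length a k j : (j + k)%N = M ->
  word_ball S (a.+1 ^ k) (c j ^ (t ^+ a))%g.
Proof.
elim: a k j => [|a IHa] [|k] j e.
- by rewrite addn0 in e; rewrite e comm_M conj1g; exact: word_ball1.
- by rewrite expg0 conjg1 exp1n; exact: word_ball_gen.
- by rewrite addn0 in e; rewrite e comm_M conj1g; exact: word_ball1.
rewrite expgS conjgM conj_c conjMg.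
have h1 := IHa _ _ e; have h2 : word_ball S (a.+1 ^ k) (c j.+1 ^ (t ^+ a))%g.
  by apply: IHa; rewrite addSnnS.
apply: word_ballW (word_ballM h1 h2).
rewrite [X in (_ <= X)%N]expnS mulSn addnC leq_add ?leq_expSn //.
by rewrite expnS leq_mul2l leq_expSn orbT.
Qed.

(** Here [c j ^ t^-1 = c j * (c j.+1 ^ t^-1)^-1]: the factor of index [j.+1] carries the full power
    of [t], hence the induction on [k] outside the one on [b]. *)
Lemma conj_neg_length b k j : (j + k)%N = M ->
  word_ball S (b.+1 ^ k) (c j ^ (t ^- b))%g.
Proof.
elim: k b j => [|k IHk] b j e.
  by rewrite addn0 in e; rewrite e comm_M conj1g; exact: word_ball1.
elim: b => [|b IHb].
  by rewrite expg0 invg1 conjg1 exp1n; exact: word_ball_gen.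
have conj_inv : (c j ^ t^-1 = c j * (c j.+1 ^ t^-1)^-1)%g.
  by apply: (mulIg (c j.+1 ^ t^-1)%g); rewrite mulgVK -conjMg -conj_c conjgK.
have -> : (c j ^ (t ^- b.+1) = c j ^ (t ^- b) * (c j.+1 ^ (t ^- b.+1))^-1)%g.
  rewrite -!expVgn !expgS conjgM conj_inv conjMg; congr (_ * _)%g.
  by rewrite conjVg conjgM.
have h2 : word_ball S (b.+2 ^ k) (c j.+1 ^ (t ^- b.+1))%g.
  by apply: IHk; rewrite addSnnS.
apply: word_ballW (word_ballM IHb (word_ballV h2)).
rewrite [X in (_ <= X)%N]expnS [X in (_ <= X)%N]mulSn addnC leq_add2l expnS.
by rewrite leq_mul2l leq_expSn orbT.
Qed.

End Collection.

(* Letters [t] are collected on the left; conjugating the other letters by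
   powers of [t] costs words of polynomial length in iterated commutators. *)
Lemma collect_left (G : groupType) (t : G) (T S : set G) (M N : nat) :
  (forall x j, T x -> S (iter_comm t x j)) ->
  (forall x, T x -> iter_comm t x M = 1%g) ->
  forall n g, (n <= N)%N -> word_ball (t |` T) n g ->
  exists a b h, [/\ (a <= n)%N, (b <= n)%N,
    word_ball S (n * (N.+1 ^ M * N.+1 ^ M)) h & g = (t ^+ a * t ^- b * h)%g].
Proof.
move=> ST S1; elim=> [|n IHn] g nN.
  move=> [j]; rewrite leqn0 => /eqP -> e; rewrite -(e : 1%g = g).
  exists 0%N, 0%N, 1%g; split=> //; first exact: word_ball1.
  by rewrite !expg0 invg1 !mulg1.
have nN' : (n <= N)%N by lia.
case/word_ballS => [/(IHn _ nN')[a [b [h [an bn wh ->]]]]|].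
  exists a, b, h; split=> //; [lia|lia|].
  by apply: word_ballW wh; rewrite leq_mul2r leqnSn orbT.
move=> [z [y [Sz /(IHn _ nN')[a [b [h [an bn wh ->]]]] ->]]].
have wh' : word_ball S (n.+1 * (N.+1 ^ M * N.+1 ^ M)) h.
  by apply: word_ballW wh; rewrite leq_mul2r leqnSn orbT.
have collect_x x : T x -> word_ball S (N.+1 ^ M * N.+1 ^ M) (x ^ (t ^+ a * t ^- b))%g.
  move=> Tx; rewrite conjgM.
  (* Conjugation by [t ^+ a] yields a word in iterated commutators, whose letters are then
     conjugated by [t ^- b]; the two lengths multiply. *)
  have h1 : word_ball [set iter_comm t x j | j in setT] (a.+1 ^ M) (x ^ (t ^+ a))%g.
    by apply: (@conj_pos_length _ t x _ M _ (S1 _ Tx) a M 0).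
  have h2 u : [set iter_comm t x j | j in setT] u -> word_ball S (b.+1 ^ M) (u ^ (t ^- b))%g.
    move=> [j _ <-]; case: (leqP j M) => jM.
      apply: (@word_ballW _ _ (b.+1 ^ (M - j))); first by rewrite leq_pexp2l // leq_subr.
      by apply: (@conj_neg_length _ t x S M _ (S1 _ Tx)); [move=> i; exact: ST|rewrite subnKC].
    have -> : iter_comm t x j = 1%g.
      rewrite /iter_comm -(subnK (ltnW jM)) iterD -/(iter_comm t x M) (S1 _ Tx).
      by elim: (j - M)%N => //= i ->; rewrite comm1g.
    by rewrite conj1g; exact: word_ball1.
  apply: (word_ballW _ (word_ball_conj h2 h1)).
  by case: (M) => // M'; apply: leq_mul; rewrite leq_exp2r //; lia.
have move_z : word_ball S (N.+1 ^ M * N.+1 ^ M) (z ^ (t ^+ a * t ^- b))%g ->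
    exists a0 b0 h0, [/\ (a0 <= n.+1)%N, (b0 <= n.+1)%N,
    word_ball S (n.+1 * (N.+1 ^ M * N.+1 ^ M)) h0 &
    (z * (t ^+ a * t ^- b * h) = t ^+ a0 * t ^- b0 * h0)%g].
  move=> wz; exists a, b, (z ^ (t ^+ a * t ^- b) * h)%g; split; [lia|lia| |].
    by rewrite mulSn; exact: word_ballM.
  by rewrite mulgA (conjgC z) -mulgA.
(* A letter [t] or its inverse raises one exponent, as powers of [t] commute; any other letter is
   moved to the right of them, conjugated. *)
case: Sz => -[zt|Tz].
- exists a.+1, b, h; split => //; first lia.
  by rewrite zt expgS !mulgA.
- by apply: move_z; exact: collect_x.
- exists a, b.+1, h; split => //; first lia.
  have -> : z = (t^-1)%g by rewrite -zt invgK.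
  rewrite -!expVgn expgS !mulgA; congr (_ * _ * _)%g.
  by apply: (@commuteX _ t^-1%g t a); apply/commute_sym/commuteV.
- apply: move_z; rewrite -[z]invgK conjVg; apply: word_ballV.
  exact: collect_x.
Qed.

Definition polynomially_bounded (G : groupType) (A : nat -> set G) : Prop :=
  exists c D : nat, forall n, exists2 s : seq G, (size s <= c * n.+1 ^ D)%N &
    forall x, A n x -> x \in s.

Lemma polynomially_bounded_collect (G : groupType) (t : G) (T S : set G) (M : nat) :
  (forall x j, T x -> S (iter_comm t x j)) ->
  (forall x, T x -> iter_comm t x M = 1%g) ->
  polynomially_bounded (word_ball S) -> polynomially_bounded (word_ball (t |` T)).
Proof.
move=> ST S1 [c [D hS]].
(* There are [n.+1 ^ 2] pairs of exponents, and the rest has length [n * n.+1 ^ (M + M)], whose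
   successor is at most [n.+1 ^ (M + M).+1]. *)
exists c, (2 + (M + M).+1 * D)%N => n.
have [s ss hs] := hS (n * (n.+1 ^ M * n.+1 ^ M))%N.
exists [seq (x * h)%g | x <- [seq (t ^+ a * t ^- b)%g | a <- iota 0 n.+1, b <- iota 0 n.+1],
                   h <- s].
  rewrite !size_allpairs !size_iota expnD mulnn mulnCA leq_mul2l; apply/orP; right.
  apply: leq_trans ss _; rewrite leq_mul2l; apply/orP; right.
  rewrite expnM; case: (posnP D) => [->//|D0]; rewrite leq_exp2r //.
  rewrite expnS expnD -[X in (X <= _)%N]addn1 mulSn addnC leq_add //.
  by rewrite muln_gt0 expn_gt0.
move=> g /(collect_left ST S1 (leqnn n))[a [b [h [an bn /hs wh ->]]]].
apply: allpairs_f => //.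
by apply: (allpairs_f (fun a b => (t ^+ a * t ^- b)%g)); rewrite mem_iota; lia.
Qed.

Lemma polynomially_bounded_subset (G : groupType) (A B : nat -> set G) :
  (forall n, A n `<=` B n) -> polynomially_bounded B -> polynomially_bounded A.
Proof.
move=> AB [c [D h]]; exists c, D => n; have [s ss hs] := h n.
by exists s => // x /AB/hs.
Qed.

Lemma lower_central_comm (G : groupType) n (x y : G) :
  lower_central n x -> lower_central n.+1 [~ x, y]%g.
Proof. by move=> Lx H [_ sub]; apply: sub; exists x, y. Qed.

Lemma lower_centralS (G : groupType) n :
  @lower_central G n.+1 `<=` @lower_central G n.
Proof.
elim: n => [|n IHn] // g Lg H [Hs sub]; apply: Lg; split=> // _ [x [y [Lx ->]]].
by apply: sub; exists x, y; split=> //; exact: IHn.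
Qed.

Lemma lower_centralW (G : groupType) m n : (m <= n)%N ->
  @lower_central G n `<=` @lower_central G m.
Proof.
move=> /subnK <-; elim: (n - m)%N => [//|k IHk] g /lower_centralS; exact: IHk.
Qed.

Lemma lower_central_iter_comm (G : groupType) n (t x : G) j :
  lower_central n x -> lower_central (j + n)%N (iter_comm t x j).
Proof. by move=> Lx; elim: j => //= j IHj; exact: lower_central_comm. Qed.

(** Induction from the bottom of the lower central series. In a step, the generators [T1] of the new
    layer are collected one by one; collecting [t] adds commutators with [t], which lie one layer
    deeper and join [T2], so [T1] shrinks. *)
Lemma nilpotent_polynomially_bounded (G : groupType) (m : nat) :
  @lower_central G m `<=` [set 1%g] ->
  forall k, (k <= m)%N -> forall T : seq G,
    (forall x, x \in T -> lower_central (m - k)%N x) ->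
    polynomially_bounded (word_ball [set` T]).
Proof.
move=> Lm; elim=> [|k IHk] km T hT.
  exists 1%N, 0%N => n; exists [:: 1%g] => // g.
  suff h : forall n g, word_ball [set` T] n g -> g = 1%g by move=> /h ->; rewrite inE.
  elim=> [|i IHi] {}g; first by move=> [j]; rewrite leqn0 => /eqP -> /esym.
  case/word_ballS => [/IHi//|[z [y [Tz /IHi -> ->]]]]; rewrite mulg1.
  case: Tz => /hT; rewrite subn0 => /Lm //= e.
  by rewrite -[z]invgK e invg1.
suff h : forall T1 T2 : seq G, (forall x, x \in T1 -> lower_central (m - k.+1)%N x) ->
    (forall x, x \in T2 -> lower_central (m - k)%N x) ->
    polynomially_bounded (word_ball [set` T1 ++ T2]).
  by have := h T [::] hT; rewrite cats0; apply.
elim=> [|t T1 IH1] T2 h1 h2; first by apply: IHk => //; lia.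
pose U := T1 ++ T2.
pose C := [seq iter_comm t x j | x <- U, j <- iota 1 m].
have hU x : x \in U -> lower_central (m - k.+1)%N x.
  rewrite mem_cat => /orP[xT|/h2]; first by apply: h1; rewrite inE xT orbT.
  by apply: lower_centralW; lia.
apply: (@polynomially_bounded_subset _ _ (word_ball (t |` [set` U]))).
  by move=> n; apply: word_ball_subset => x /=; rewrite inE => /predU1P[->|]; [left|right].
have iter1 x j : x \in U -> (m <= j)%N -> iter_comm t x j = 1%g.
  move=> /hU/(lower_central_iter_comm t j) + mj.
  by move=> L; apply: Lm; apply: lower_centralW L; lia.
have memS y : (y \in T1 ++ (1%g :: T2 ++ C)) = [|| y == 1%g, y \in U | y \in C].
  by rewrite !mem_cat inE mem_cat; do !case: (_ \in _); case: eqP.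
(* The entry [1] of the list stands for the commutators with [j >= m]; [j = 0] gives the elements of
   [U] themselves. *)
apply: (@polynomially_bounded_collect _ t _ [set` T1 ++ (1%g :: T2 ++ C)] m).
- move=> x j xU /=; rewrite memS; case: (leqP m j) => jm.
    by rewrite iter1 // eqxx.
  case: j jm => [|j] jm; first by rewrite [iter_comm _ _ _]/= xU orbT.
  suff -> : iter_comm t x j.+1 \in C by rewrite !orbT.
  by apply: (allpairs_f (iter_comm t)); rewrite // mem_iota; lia.
- by move=> x xU; exact: iter1.
apply: IH1 => x.
  by move=> xT; apply: h1; rewrite inE xT orbT.
rewrite inE mem_cat => /or3P[/eqP->|/h2//|].
  by case: (m - k)%N => [|i] // H [[]].
move=> /allpairsP[[y j] /= [/hU/(lower_central_iter_comm t j) L jm ->]].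
by apply: lower_centralW L; move: jm; rewrite mem_iota; lia.
Qed.

(** * Products of trees *)

Lemma colorable_fin (X Y : Type) (K : finType) (col : X -> K) (lab : X -> Y)
    (close bnd : X -> X -> Prop) :
  (forall x x', col x = col x' -> close x x' -> lab x = lab x') ->
  (forall x x', col x = col x' -> lab x = lab x' -> bnd x x') ->
  colorable #|K| close bnd.
Proof.
move=> h1 h2; exists Y, (fun x => enum_rank (col x) : nat), lab.
by split=> [x|x x' /val_inj/enum_rank_inj|x x' /val_inj/enum_rank_inj];
  [exact: ltn_ord|exact: h1|exact: h2].
Qed.

Section Trees.
Variables (R : realType) (T : Type) (d : T -> T -> R).
Hypothesis treed : metric_tree d.

Definition geodesic (x y : T) (c : R -> T) : Prop :=
  [/\ c 0 = x, c (d x y) = y & forall s t, 0 <= s <= d x y -> 0 <= t <= d x y ->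
      d (c s) (c t) = `|s - t|].

Let treed_metric : is_metric d. Proof. by have [] := treed. Qed.
Let dist0 x : d x x = 0. Proof. by have [d0 _ _] := treed_metric; apply/d0. Qed.
Let distC x y : d x y = d y x. Proof. by have [_ dC _] := treed_metric. Qed.
Let distT x y z : d x z <= d x y + d y z. Proof. by have [_ _ dT] := treed_metric. Qed.
Let dist_ge0 x y : 0 <= d x y. Proof. exact: metric_ge0. Qed.

Lemma geodesic_exists x y : exists c, geodesic x y c.
Proof. by have [_ /(_ x y)[A [[c [c0 c1 cd _]] _]] _] := treed; exists c. Qed.

Lemma geodesic_dist x y c t : geodesic x y c -> 0 <= t <= d x y ->
  d x (c t) = t /\ d (c t) y = d x y - t.
Proof.
move=> [c0 c1 cd] /andP[t0 t1]; split.
  by rewrite -{1}c0 cd ?lexx ?t0 ?t1 ?dist_ge0 //; rewrite sub0r normrN ger0_norm.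
by rewrite -{1}c1 cd ?lexx ?t0 ?t1 ?dist_ge0 // distrC ger0_norm // subr_ge0.
Qed.

Lemma subgeodesic x y c a b : geodesic x y c -> 0 <= a <= b -> b <= d x y ->
  geodesic_segment d (c a) (c b) [set c t | t in [set t | a <= t <= b]].
Proof.
move=> [c0 c1 cd] /andP[a0 ab] b1.
have dab : d (c a) (c b) = b - a.
  rewrite cd; [|by rewrite a0 (le_trans ab)|by rewrite b1 (le_trans a0)].
  by rewrite distrC ger0_norm // subr_ge0.
exists (fun s => c (a + s)); rewrite dab; split.
- by rewrite addr0.
- by rewrite subrKC.
- move=> s t /andP[s0 s1] /andP[t0 t1]; rewrite cd; last 2 first.
  + by apply/andP; lra.
  + by apply/andP; lra.
  by congr `|_|; ring.
- apply/seteqP; split=> _ [t /= /andP[t0 t1] <-].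
    by exists (t - a); [apply/andP; lra|rewrite subrKC].
  by exists (a + t) => //; apply/andP; lra.
Qed.

Lemma geodesic_segment_sym x y A :
  geodesic_segment d x y A -> geodesic_segment d y x A.
Proof.
move=> [c [c0 c1 cd ->]]; exists (fun s => c (d x y - s)); rewrite (distC y x); split.
- by rewrite subr0.
- by rewrite subrr.
- move=> s t /andP[s0 s1] /andP[t0 t1]; rewrite cd; last 2 first.
  + by apply/andP; lra.
  + by apply/andP; lra.
  by rewrite distrC; congr `|_|; ring.
- apply/seteqP; split=> _ [t /= /andP[t0 t1] <-].
    by exists (d x y - t); [apply/andP; lra|rewrite subKr].
  by exists (d x y - t) => //; apply/andP; lra.
Qed.

(** Up to [t] both geodesics trace the unique segment from [e] to their common point, on which the
    distance to [e] determines a point. *)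
Lemma geodesic_prefix e x x' c c' t a : geodesic e x c -> geodesic e x' c' ->
  0 <= t <= d e x -> t <= d e x' -> c t = c' t -> 0 <= a <= t -> c a = c' a.
Proof.
move=> gc gc' /andP[t0 t1] t1' e0 /andP[a0 at_].
have [c0 _ _] := gc; have [c0' _ _] := gc'.
have s1 : geodesic_segment d e (c t) [set c s | s in [set s | 0 <= s <= t]].
  by rewrite -{1}c0; apply: (subgeodesic gc); rewrite ?lexx ?t0.
have s2 : geodesic_segment d e (c t) [set c' s | s in [set s | 0 <= s <= t]].
  by rewrite e0 -{1}c0'; apply: (subgeodesic gc'); rewrite ?lexx ?t0.
have [_ uniq _] := treed; have [A [_ uA]] := uniq e (c t).
have : [set c s | s in [set s | 0 <= s <= t]] (c a) by exists a => //; apply/andP.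
rewrite -(uA _ s1) (uA _ s2) => -[s /= /andP[s0 st] e1].
have [h _] : d e (c a) = a /\ d (c a) x = d e x - a.
  by apply: geodesic_dist gc _; apply/andP; lra.
have [h' _] : d e (c' s) = s /\ d (c' s) x' = d e x' - s.
  by apply: geodesic_dist gc' _; apply/andP; lra.
by rewrite -e1; congr c'; rewrite -h' e1 h.
Qed.

(** The strict inequality says that [a] is below the Gromov product of [x] and [x'] at [e]. If the
    geodesics separated at some [t < a], their tails would meet in [c t] only and concatenate to a
    geodesic, making [d x x'] too large. *)
Lemma geodesics_agree e x x' c c' a : geodesic e x c -> geodesic e x' c' ->
  0 <= a <= d e x -> a <= d e x' -> d x x' < (d e x - a) + (d e x' - a) ->
  c a = c' a.
Proof.
move=> gc gc' /andP[a0 a1] a1' lt.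
have [c0 cx cd] := gc; have [c0' cx' cd'] := gc'.
pose S := [set t | [/\ 0 <= t, t <= d e x, t <= d e x' & c t = c' t]].
have S0 : S 0 by split; rewrite ?lexx ?dist_ge0 // c0.
have Sub : has_ubound S by exists (d e x) => t [].
have Ssup : has_sup S by split; [exists 0|].
pose t := sup S.
have t0 : 0 <= t by apply: ub_le_sup.
have t1 : t <= d e x by apply: ge_sup; [exists 0|move=> s []].
have t1' : t <= d e x' by apply: ge_sup; [exists 0|move=> s []].
have ct : c t = c' t.
  have [d0 _ _] := treed_metric; apply/d0/le_anti; rewrite dist_ge0 andbT.
  apply/ler_addgt0Pl => eps eps0; rewrite addr0.
  have [s [s0 s1 s1' cs] st] := sup_adherent (divr_gt0 eps0 (ltr0n _ 2)) Ssup.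
  have st' : s <= t by apply: ub_le_sup.
  have := distT (c t) (c s) (c' t); rewrite {2}cs cd ?t0 ?s0 //.
  rewrite cd' ?t0 ?s0 // ger0_norm ?subr_ge0 // ler0_norm ?subr_le0 //.
  rewrite -/t in st; lra.
case: (leP a t) => [at_|ta].
  by apply: (geodesic_prefix gc gc' _ t1' ct); rewrite ?t0 ?a0.
have sA : geodesic_segment d x (c t) [set c s | s in [set s | t <= s <= d e x]].
  by rewrite -{1}cx; apply/geodesic_segment_sym/(subgeodesic gc); rewrite ?t0.
have sB : geodesic_segment d (c t) x' [set c' s | s in [set s | t <= s <= d e x']].
  by rewrite ct -{1}cx'; apply: (subgeodesic gc'); rewrite ?t0.
have AB : [set c s | s in [set s | t <= s <= d e x]]
    `&` [set c' s | s in [set s | t <= s <= d e x']] = [set c t].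
  apply/seteqP; split=> [_ [[s /= /andP[ts s1] <-] [s' /andP[ts' s1'] e1]]|_ ->]; last first.
    by split; exists t => //=; rewrite lexx.
  have [h _] : d e (c s) = s /\ d (c s) x = d e x - s.
    by apply: geodesic_dist gc _; apply/andP; lra.
  have [h' _] : d e (c' s') = s' /\ d (c' s') x' = d e x' - s'.
    by apply: geodesic_dist gc' _; apply/andP; lra.
  have ss' : s' = s by rewrite -h' e1 h.
  subst s'; have : s <= t by apply: ub_le_sup => //; split=> //; lra.
  by move=> st; rewrite (_ : s = t) //; apply/le_anti/andP.
have [_ _ /(_ _ _ _ _ _ sA sB AB)[k [k0 k1 kd kA]]] := treed.
have : ([set c s | s in [set s | t <= s <= d e x]]
    `|` [set c' s | s in [set s | t <= s <= d e x']]) (c t).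
  by left; exists t => //=; rewrite lexx.
rewrite kA => -[s /= sx ks].
have gk : geodesic x x' k by [].
have [h1 h2] := geodesic_dist gk sx; rewrite ks in h1 h2.
have tx : 0 <= t <= d e x by rewrite t0.
have tx' : 0 <= t <= d e x' by rewrite t0.
have [_ h3] := geodesic_dist gc tx; have [_ h4] := geodesic_dist gc' tx'.
rewrite -ct in h4; rewrite (distC x) in h1; exfalso; lra.
Qed.

(** Annuli of width [r] around [e] are colored by parity and cut into cells by the point at distance
    [(k - 1) * r] on the geodesic from [e]. In a tree these points coincide for close points of one
    annulus, and each point is within [2 * r] of its own. *)
Lemma tree_colorable (e : T) (r : R) : 0 < r ->
  colorable #|{: bool}| (fun x y => d x y <= r) (fun x y => d x y <= 4 * r).
Proof.
move=> r0; have /choice[c hc] := geodesic_exists e.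
pose k x := Num.truncn (d e x / r); pose a x := (k x).-1%:R * r.
have hk x : (k x)%:R * r <= d e x < (k x).+1%:R * r.
  rewrite -ler_pdivlMr // -ltr_pdivrMr //; apply: truncn_itv.
  by rewrite divr_ge0 // ltW.
have hka x : 0 <= a x <= d e x /\ (k x = 0%N \/ (k x)%:R * r = a x + r).
  have /andP[h _] := hk x; rewrite /a; move: h; case: (k x) => [|n] /=.
    by rewrite mul0r lexx dist_ge0; split=> //; left.
  rewrite -natr1 => h; have : 0 <= n%:R * r by rewrite mulr_ge0 // ltW.
  by split; [apply/andP; lra|right; lra].
have hca x : d e (c x (a x)) = a x /\ d (c x (a x)) x = d e x - a x.
  by apply: geodesic_dist (hc x) _; have [] := hka x.
apply: (@colorable_fin _ (nat * T)%type _ (fun x => odd (k x)) (fun x => (k x, c x (a x)))).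
  move=> x x' eo le; have /andP[l1 u1] := hk x; have /andP[l1' u1'] := hk x'.
  have close y y' : d y y' <= r -> (k y < (k y').+2)%N.
    move=> le'; rewrite -(ltr_nat R) -(ltr_pM2r r0).
    have /andP[b1 _] := hk y; have /andP[_ b2] := hk y'.
    have := distT e y' y; rewrite (distC y' y) -natr1; rewrite mulrDl mul1r; lra.
  have ek : k x = k x'.
    have := close _ _ le; rewrite distC in le; have := close _ _ le.
    lia.
  congr pair => //; have ea : a x = a x' by rewrite /a ek.
  have [c0 _ _] := hc x; have [c0' _ _] := hc x'.
  have [/andP[a0 a1] k1] := hka x; have [/andP[a0' a1'] k1'] := hka x'.
  rewrite -ea in a1' *; case: k1 => [kx0|k1].
    by rewrite /a kx0 mul0r c0 c0'.
  case: k1' => [kx0|k1']; first by rewrite /a ek kx0 mul0r c0 c0'.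
  apply: (geodesics_agree (hc x) (hc x')); rewrite ?a0 //; lra.
move=> x x' _ [ek el]; have [_ h] := hca x; have [_ h'] := hca x'.
have /andP[_ u1] := hk x; have /andP[_ u1'] := hk x'.
have [_ k1] := hka x; have [_ k1'] := hka x'.
have := distT x (c x (a x)) x'; rewrite (distC x (c x _)) h {1}el h'.
have ax : 0 <= a x by have [/andP[]] := hka x.
have ax' : 0 <= a x' by have [/andP[]] := hka x'.
rewrite -natr1 mulrDl mul1r in u1; rewrite -natr1 mulrDl mul1r in u1'.
case: k1 => [kx0|k1]; case: k1' => [kx0'|k1']; rewrite ?kx0 ?kx0' ?mul0r in u1 u1' *; lra.
Qed.

End Trees.

(** Cells are products of cells of the factors: closeness for the sum of distances implies closeness
    in each coordinate, and the [N] bounds add up. *)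
Lemma product_of_trees_colorable (R : realType) (N : nat) (T : 'I_N -> Type)
    (d : forall j, T j -> T j -> R) (e : forall j, T j) (r : R) :
  (forall j, metric_tree (d j)) -> 0 < r ->
  colorable #|{: {ffun 'I_N -> 'I_#|{: bool}|} }|
    (fun x y => l1_dist d x y <= r) (fun x y => l1_dist d x y <= N%:R * (4 * r)).
Proof.
move=> tree r0.
have d0 j x y : 0 <= d j x y by have [m _ _] := tree j; exact: metric_ge0.
have hj j := tree_colorable (tree j) (e j) r0.
have /choice[Y hY] : forall j, exists Y : Type, exists (col : T j -> nat) (lab : T j -> Y),
  [/\ forall x, (col x < #|{: bool}|)%N,
      forall x x', col x = col x' -> d j x x' <= r -> lab x = lab x'
    & forall x x', col x = col x' -> lab x = lab x' -> d j x x' <= 4 * r].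
  by move=> j; exact: hj.
have col_ex j : {p : (T j -> nat) * (T j -> Y j) |
  [/\ forall x, (p.1 x < #|{: bool}|)%N,
      forall x x', p.1 x = p.1 x' -> d j x x' <= r -> p.2 x = p.2 x'
    & forall x x', p.1 x = p.1 x' -> p.2 x = p.2 x' -> d j x x' <= 4 * r]}.
  by apply: cid; have [col [lab h]] := hY j; exists (col, lab).
pose col j := (sval (col_ex j)).1; pose lab j := (sval (col_ex j)).2.
have colP j := svalP (col_ex j).
have colK j x : (col j x < #|{: bool}|)%N by have [h _ _] := colP j; exact: h.
apply: (@colorable_fin _ (forall j, Y j) _
  (fun x => [ffun j => Ordinal (colK j (x j))]) (fun x j => lab j (x j))).
  move=> x x' /ffunP ec le; apply: functional_extensionality_dep => j.
  have [_ h _] := colP j; apply: h.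
    by have := ec j; rewrite !ffunE => /(congr1 val).
  apply: le_trans le; rewrite /l1_dist (bigD1 j) //= lerDl.
  by apply: sumr_ge0.
move=> x x' /ffunP ec el; rewrite /l1_dist.
apply: le_trans (_ : \sum_(j < N) 4 * r <= _); last first.
  by rewrite sumr_const card_ord -[leLHS]mulr_natl.
apply: ler_sum => j _; have [_ _ h] := colP j; apply: h.
  by have := ec j; rewrite !ffunE => /(congr1 val).
exact: (congr1 (fun f => f j) el).
Qed.

(** * Subgroups and change of generators *)

Lemma generated_subgroup (G : groupType) (S : set G) : is_subgroup (generated S).
Proof.
split=> [H [[]]//|x y gx gy H HS|x gx H HS]; have [[_ HM HV] _] := HS.
  by apply: HM; [exact: gx|exact: gy].
by apply: HV; exact: gx.
Qed.

Lemma word_ball_generated (G : groupType) (S : set G) n : word_ball S n `<=` generated S.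
Proof.
have [g1 gM gV] := generated_subgroup S.
elim: n => [|n IHn] x.
  by move=> [j]; rewrite leqn0 => /eqP -> e; rewrite -(e : 1%g = x).
case/word_ballS => [/IHn//|[z [y [Sz /IHn gy ->]]]]; apply: gM => //.
case: Sz => Sz; first exact: sub_gen_smallest.
by rewrite -[z]invgK; apply: gV; exact: sub_gen_smallest.
Qed.

Lemma word_ball_change (G : groupType) (S S' : set G) :
  finite_set S -> S `<=` generated S' ->
  exists q, forall n x, word_ball S n x -> word_ball S' (n * q) x.
Proof.
move=> finS sub.
have /choice[len hlen] : forall x, exists n, S x -> word_ball S' n x.
  move=> x; have [/sub Sx|nS] := pselect (S x); last by exists 0%N.
  have [n w] : exists n, walk (cayley S') n 1%g x.
    by apply: walk_generated; rewrite invg1 mul1g.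
  by exists n => _; exists n.
have [q hq] := finite_set_bounded len finS; exists q => n x w.
rewrite -[x]conjg1; apply: word_ball_conj w => y Sy; rewrite conjg1.
exact: word_ballW (hq _ Sy) (hlen _ Sy).
Qed.

Lemma word_dist_le (R : realType) (G : groupType) (S : set G) (n : nat) (x y : G) :
  word_ball S n (x^-1 * y)%g -> word_dist R S x y <= n%:R.
Proof.
move=> [j jn w]; apply: le_trans (_ : j%:R <= _); last by rewrite ler_nat.
apply: ge_inf; first by exists 0 => _ [i _ <-]; rewrite ler0n.
by exists j => //=; rewrite -[x]mulg1 -[y](mulVKg x); exact: walk_cayleyM.
Qed.

Lemma word_ball_of_dist (R : realType) (G : groupType) (S : set G) (n : nat) (x y : G) :
  generated S (x^-1 * y)%g -> word_dist R S x y <= n%:R -> word_ball S n (x^-1 * y)%g.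
Proof.
move=> /walk_generated[i wi] le.
have [_ [j wj <-]] : exists2 z, [set (k%:R : R) | k in [set k | walk (cayley S) k x y]] z & z < n.+1%:R.
  apply: inf_lt; first by exists i%:R, i.
  by apply: le_lt_trans le _; rewrite ltr_nat.
rewrite ltr_nat ltnS => jn; exists j => //.
by rewrite -(mulVg x); exact: walk_cayleyM.
Qed.

(* The bound is linear in the scale because trees are colorable with linear bounds. *)
Lemma peripheral_colorable (R : realType) (G : groupType) (P S : set G) :
  is_subgroup P -> finite_set S -> generated S = P -> qi_embeds_in_trees R P ->
  exists N A, forall r, (0 < r)%N ->
    colorable N (fun x y : G => word_ball S r (x^-1 * y)%g)
                (fun x y : G => word_ball S (A * r) (x^-1 * y)%g).
Proof.
move=> [P1 PM PV] finS genS [S1 [[finS1 genS1] [N [T [d [f [tree [K [c [K1 c0 qi]]]]]]]]]].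
have [q hq] : exists q, forall n x, word_ball S n x -> word_ball S1 (n * q) x.
  by apply: word_ball_change => //; rewrite genS1 -genS; exact: sub_gen_smallest.
have [q' hq'] : exists q, forall n x, word_ball S1 n x -> word_ball S (n * q) x.
  by apply: word_ball_change => //; rewrite genS -genS1; exact: sub_gen_smallest.
(* A representative of each left coset: [x] is translated to the element [(rep x)^-1 * x] of [P],
   and the label remembers the coset. *)
pose rep x := xget 1%g [set h | P (x^-1 * h)%g].
have rep_eq x y : P (x^-1 * y)%g -> rep x = rep y.
  move=> Pxy; congr xget; apply/seteqP; split=> h /= Ph.
    by rewrite -[h](mulVKg x) mulgA; apply: PM => //; rewrite -[(y^-1 * x)%g]invgK invgM invgK; exact: PV.
  by rewrite -[h](mulVKg y) mulgA; exact: PM.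
have repP x : P ((rep x)^-1 * x)%g.
  have -> : ((rep x)^-1 * x = (x^-1 * rep x)^-1)%g by rewrite invgM invgK.
  apply: PV.
  by apply: (@xgetPex _ 1%g [set h | P (x^-1 * h)%g]); exists x => /=; rewrite mulVg.
have divE x y : rep x = rep y ->
    (((rep x)^-1 * x)^-1 * ((rep y)^-1 * y) = x^-1 * y)%g.
  by move=> ->; rewrite invgM invgK -mulgA mulVKg.
(* The lower quasi-isometry bound turns tree diameter [N * (4 * r')] into [K * (N * (4 * r') + c)];
   since [r >= 1], this is at most [M * r]. *)
pose M := K * (N%:R * 4 * (K * q%:R + c + 1) + c).
have q0 : (0 : R) <= q%:R by [].
have Kq0 : 0 <= K * q%:R by rewrite mulr_ge0 //; lra.
exists #|{: {ffun 'I_N -> 'I_#|{: bool}|} }|, (Num.bound M * q')%N => r r0.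
have r1 : (1 : R) <= r%:R by rewrite ler1n.
pose r' := K * (r * q)%:R + c + 1.
have r'E : r' <= (K * q%:R + c + 1) * r%:R.
  have := ler_wpM2l c0 r1; rewrite /r' natrM; lra.
have r'0 : 0 < r' by rewrite /r' natrM mulrC; have := mulr_ge0 Kq0 (ler0n R r); lra.
have [Y [col [lab [h1 h2 h3]]]] := product_of_trees_colorable (f 1%g) tree r'0.
exists (G * Y)%type, (fun x => col (f ((rep x)^-1 * x)%g)),
  (fun x => (rep x, lab (f ((rep x)^-1 * x)%g))); split=> [x|x y ec w|x y ec [er el]].
- exact: h1.
- have er : rep x = rep y by apply: rep_eq; rewrite -genS; exact: word_ball_generated w.
  congr pair => //; apply: h2 => //.
  have /andP[_ le] := qi _ _ (repP x) (repP y).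
  move: w; rewrite -(divE _ _ er) => /hq/(word_dist_le R) le2.
  by have := ler_wpM2l (le_trans ler01 K1) le2; rewrite /r'; lra.
- have := h3 _ _ ec el; have /andP[le _] := qi _ _ (repP x) (repP y).
  move=> le2; rewrite -(divE _ _ er) mulnAC; apply: hq'.
  apply: (@word_ball_of_dist R).
    by rewrite genS1; apply: PM; [apply: PV|]; exact: repP.
  move: le; set w := word_dist _ _ _ _ => le.
  have KwE : w = K * (K^-1 * w) by rewrite mulVKf // gt_eqF // (lt_le_trans ltr01).
  have wle : w <= K * (N%:R * (4 * r') + c).
    by rewrite KwE ler_wpM2l ?(le_trans ler01) //; lra.
  have MrE : K * (N%:R * (4 * r') + c) <= M * r%:R.
    rewrite /M -mulrA ler_wpM2l ?(le_trans ler01) //.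
    have := ler_wpM2l c0 r1; have := ler_wpM2l (mulr_ge0 (ler0n R N) (ler0n R 4)) r'E.
    lra.
  have M0 : 0 <= M by rewrite /M !mulr_ge0 ?addr_ge0 ?mulr_ge0 //; lra.
  have := ler_wpM2r (ler0n R r) (ltW (archi_boundP M0)).
  rewrite natrM; lra.
Qed.

(** * Hyperbolic and relatively hyperbolic groups *)

(** Using the cells themselves as labels fixes the label type, so that colorings can be chosen
    simultaneously for a family of scales. *)
Lemma colorable_cells (X : Type) (N : nat) (close bnd : X -> X -> Prop) :
  colorable N close bnd -> exists (col : X -> nat) (cell : X -> set X),
  [/\ forall x, (col x < N)%N,
      forall x x', col x = col x' -> close x x' -> cell x = cell x'
    & forall x x', col x = col x' -> cell x = cell x' -> bnd x x'].
Proof.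
move=> [Y [col [lab [h1 h2 h3]]]].
exists col, (fun x => [set y | col y = col x /\ lab y = lab x]); split=> // x x' ec.
  by move=> /(h2 _ _ ec) el; rewrite ec el.
move=> e; apply: h3 => //; have : [set y | col y = col x /\ lab y = lab x] x by [].
by rewrite e => -[].
Qed.

(** Singleton cells: the relation has degree at most the size of the ball, so a greedy coloring
    separates close points. *)
Lemma word_ball_colorable (G : groupType) (S : set G) (M : nat) :
  finite_set (word_ball S M) ->
  exists C, colorable C (fun x y : G => word_ball S M (x^-1 * y)%g) eq.
Proof.
move=> fin; have [b hb] := (finite_seqP _).1 fin.
exists (size b).
have [||p s us hs|col [colC colE]] :=
    @bounded_degree_coloring G (fun x y => word_ball S M (x^-1 * y)%g) setT (size b).
- by move=> x; rewrite mulVg; exact: word_ball1.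
- by move=> x y /word_ballV; rewrite invgM invgK.
- rewrite -(size_map (fun q => p^-1 * q)%g); apply: uniq_leq_size.
    by rewrite map_inj_uniq //; exact: mulgI.
  move=> _ /mapP[q /hs[_ w] ->].
  by move: w; rewrite hb.
exists G, col, id; split=> // [x|x x' e w]; [exact: colC|exact: colE].
Qed.

(** * The cusped space *)

Section CuspedSpace.
Variables (G : groupType) (I : finType) (P : I -> set G) (S : set G).
Local Notation V := (G + I * G * nat)%type.
Local Notation E := (cusped_adj P S).
Hypothesis genS : generated S = setT.

Definition cusped_proj (v : V) : G :=
  match v with inl x => x | inr (_, x, _) => x end.

Definition cusped_depth (v : V) : nat :=
  match v with inl _ => 0%N | inr (_, _, n) => n.+1 end.

Lemma cusped_adj_sym u v : E u v -> E v u.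
Proof.
case: u v => [x|[[i x] n]] [y|[[j y] p]] //=.
- exact: cayley_sym.
- by move=> [-> ->].
- by move=> [-> ->].
move=> [-> [[-> w]|[-> ->]|[-> ->]]]; split=> //.
- by apply: Or31; split=> //; have := word_ballV w; rewrite invgM invgK.
- exact: Or33.
- exact: Or32.
Qed.

Lemma walk_cusped_inl n x y : walk (cayley S) n x y -> walk E n (inl x) (inl y).
Proof.
elim: n x => [x -> //|n IHn x [z xz zy]].
by exists (inl z) => //; exact: IHn.
Qed.

Lemma cusped_connected u v : exists n, walk E n u v.
Proof.
have down w : exists n, walk E n w (inl (cusped_proj w)).
  case: w => [x|[[i x] n]] /=; first by exists 0%N.
  elim: n => [|n [m wm]]; first by exists 1%N, (inl x).
  by exists m.+1, (inr (i, x, n)) => //=; split=> //; exact: Or33.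
have across x y : exists n, walk E n (inl x) (inl y).
  have [n w] : exists n, walk (cayley S) n x y by apply: walk_generated; rewrite genS.
  by exists n; exact: walk_cusped_inl.
have [m wm] := down u; have [n wn] := down v.
have [k wk] := across (cusped_proj u) (cusped_proj v).
exists (m + (k + n))%N; apply: (walk_cat wm); apply: (walk_cat wk).
by apply: walk_sym => //; exact: cusped_adj_sym.
Qed.

Lemma cusped_adj_step u v : E u v ->
  (cusped_depth v <= (cusped_depth u).+1)%N /\
  word_ball S (2 ^ cusped_depth u) ((cusped_proj u)^-1 * cusped_proj v)%g.
Proof.
case: u v => [x|[[i x] n]] [y|[[j y] p]] //=.
- move=> xy; split=> //; exists 1%N => //; rewrite -(mulVg x).
  by apply: walk_cayleyM; exists y.
- by move=> [-> ->]; rewrite mulVg; split=> //; exact: word_ball1.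
- by move=> [-> ->]; rewrite mulVg; split=> //; exact: word_ball1.
move=> [_ [[-> w]|[-> ->]|[-> ->]]]; rewrite ?mulVg; split=> //; try exact: word_ball1.
- by apply: word_ball_subset w => z [].
- by lia.
Qed.

(** Depth grows by at most one per step, so each step moves the projection by at most
    [2 ^ (cusped_depth u + n)]. From depth [0] this shows that the group is coarsely embedded. *)
Lemma cusped_walk n u v : walk E n u v ->
  word_ball S (n * 2 ^ (cusped_depth u + n)) ((cusped_proj u)^-1 * cusped_proj v)%g.
Proof.
elim: n u => [u ->|n IHn u [w /cusped_adj_step[dw uw] /IHn wv]].
  by rewrite mulVg; exact: word_ball1.
have -> : ((cusped_proj u)^-1 * cusped_proj v = (cusped_proj u)^-1 * cusped_proj w *
    ((cusped_proj w)^-1 * cusped_proj v))%g by rewrite -mulgA mulVKg.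
rewrite mulSn; apply: word_ballM; first by apply: word_ballW uw; rewrite leq_exp2l // leq_addr.
by apply: word_ballW wv; rewrite leq_mul2l leq_exp2l //; apply/orP; right; lia.
Qed.

(** The start has depth [a.+1 > n], so [n] steps cannot leave the horoball. *)
Lemma horoball_walk n i x a v : (n <= a)%N -> walk E n (inr (i, x, a)) v ->
  exists y b, [/\ v = inr (i, y, b), (a <= b + n)%N, (b <= a + n)%N &
    word_ball (S `&` P i) (n * 2 ^ (a.+1 + n)) (x^-1 * y)%g].
Proof.
elim: n x a => [|n IHn] x a na.
  move=> <-; exists x, a; rewrite mulVg addn0; split=> //; exact: word_ball1.
move=> [[z [_ a0] _|[[j z] c] [<- adj] w]]; first by rewrite a0 in na.
have [nc ac ca wz] : [/\ (n <= c)%N, (a <= c.+1)%N, (c <= a.+1)%N &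
    word_ball (S `&` P i) (2 ^ a.+1) (x^-1 * z)%g].
  by case: adj na => [[<- wz]|[<- ->]|[<- ->]] na; rewrite ?mulVg; split;
    first [lia|exact: word_ball1|exact: wz].
have [y [b [-> h1 h2 h3]]] := IHn _ _ nc w; exists y, b; split=> //; try lia.
have -> : (x^-1 * y = x^-1 * z * (z^-1 * y))%g by rewrite -mulgA mulVKg.
rewrite mulSn; apply: word_ballM; first by apply: word_ballW wz; rewrite leq_exp2l // leq_addr.
by apply: word_ballW h3; rewrite leq_mul2l leq_exp2l //; apply/orP; right; lia.
Qed.

(** Climb [k] levels, cross one horizontal edge, descend [k] levels. *)
Lemma horoball_shortcut k i x y a : word_ball (S `&` P i) (2 ^ (a + k).+1) (x^-1 * y)%g ->
  walk E (k + k.+1) (inr (i, x, a)) (inr (i, y, a)).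
Proof.
move=> w; have up z : walk E k (inr (i, z, a)) (inr (i, z, a + k)%N).
  elim: k a {w} => [|k IHk] a; first by rewrite addn0.
  exists (inr (i, z, a.+1)); first by split=> //; exact: Or32.
  by rewrite addnS -addSn; exact: IHk.
apply: (walk_cat (up x)); exists (inr (i, y, a + k)%N).
  by split=> //; apply: Or31.
by apply: walk_sym (up y); exact: cusped_adj_sym.
Qed.

Variable g : V -> V -> nat.
Hypothesis hg : is_gdist E g.

(** Vertices of depth at most [D] become singleton cells; deeper ones are colored level by level
    through the peripheral colorings, whose scale [r a] dominates the displacement of walks of
    length [D]. *)
Lemma cusped_colorable (D : nat) :
  (forall M, finite_set (word_ball S M)) ->
  (forall i, exists N A, forall r, (0 < r)%N ->
    colorable N (fun x y : G => word_ball (S `&` P i) r (x^-1 * y)%g)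
                (fun x y : G => word_ball (S `&` P i) (A * r) (x^-1 * y)%g)) ->
  exists N B, colorable N (fun u v => (g u v <= D)%N) (fun u v => (g u v <= B)%N).
Proof.
move=> fin /choice[N0 /choice[A0 per]].
have [C1 [Y1 [col1 [lab1 [c1lt c1close c1bnd]]]]] := word_ball_colorable (fin (D * 2 ^ (D + D))%N).
pose N := \max_i N0 i; pose A := \max_i A0 i.
have NI i : (N0 i <= N)%N by exact: leq_bigmax.
have AI i : (A0 i <= A)%N by exact: leq_bigmax.
pose r a := (D.+1 * 2 ^ (a.+1 + D))%N.
have r0 a : (0 < r a)%N by rewrite muln_gt0 expn_gt0.
have /choice[col2 hcol2] : forall p : I * nat, exists col : G -> nat, exists cell : G -> set G,
  [/\ forall x, (col x < N)%N,
      forall x y, col x = col y ->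
        word_ball (S `&` P p.1) (r p.2) (x^-1 * y)%g -> cell x = cell y
    & forall x y, col x = col y -> cell x = cell y ->
        word_ball (S `&` P p.1) (A * r p.2) (x^-1 * y)%g].
  move=> [i a] /=; have [col [cell [h1 h2 h3]]] := colorable_cells (per i _ (r0 a)).
  exists col, cell; split=> // [x|x y ec el]; first exact: leq_trans (h1 x) (NI i).
  by apply: word_ballW (h3 _ _ ec el); rewrite leq_mul2r AI orbT.
have /choice[cell2 {}hcol2] := hcol2.
pose low (v : V) := (cusped_depth v <= D)%N.
(* Keeping the level modulo [D.+1] forces vertices of one color at distance at most [D] onto the
   same level. *)
pose kind (v : V) : option (I * 'I_D.+1) :=
  match v with inl _ => None | inr (i, _, a) => Some (i, inord (a %% D.+1)) end.
pose col (v : V) : (bool * option (I * 'I_D.+1) * 'I_(C1 + N).+1)%type :=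
  (low v, kind v, inord (if low v then col1 (cusped_proj v) else
     match v with inl _ => 0%N | inr (i, x, a) => col2 (i, a) x end)).
pose lab (v : V) : (V + nat * set G)%type :=
  if low v then inl v else
    match v with inl _ => inl v | inr (i, x, a) => inr (a, cell2 (i, a) x) end.
(* A cell at level [a] has peripheral diameter at most [A * r a = k * 2 ^ a.+1], and [k < 2 ^ k], so
   climbing [k] levels suffices at every level. This is where linearity of the peripheral bound
   enters. *)
pose k := (A * D.+1 * 2 ^ D)%N.
have inord_inj p q : (p < C1 + N)%N -> (q < C1 + N)%N ->
    inord p = inord q :> 'I_(C1 + N).+1 -> p = q.
  by move=> pl ql /(congr1 val) /=; rewrite !inordK //; lia.
have col1lt x : (col1 x < C1 + N)%N by rewrite (leq_trans (c1lt x)) // leq_addr.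
have col2lt i a x : (col2 (i, a) x < C1 + N)%N.
  by have [h _ _] := hcol2 (i, a); rewrite (leq_trans (h x)) // leq_addl.
have kind_inj i j a b : kind (inr (i, 1%g, a)) = kind (inr (j, 1%g, b)) ->
    (a <= b + D)%N -> (b <= a + D)%N -> i = j /\ a = b.
  move=> [-> /(congr1 val) /=]; rewrite !inordK ?ltn_mod // => e ab ba; split=> //.
  have := divn_eq a D.+1; have := divn_eq b D.+1; rewrite e.
  move: (a %/ D.+1)%N (b %/ D.+1)%N (b %% D.+1)%N => p q s.
  case: (ltngtP p q) => [pq|pq|-> -> -> //] eb ea.
    by have := leq_mul2r D.+1 p.+1 q; rewrite pq orbT mulSn; lia.
  by have := leq_mul2r D.+1 q.+1 p; rewrite pq orbT mulSn; lia.
exists #|{: (bool * option (I * 'I_D.+1) * 'I_(C1 + N).+1)%type}|, (k + k.+1)%N.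
apply: (@colorable_fin _ _ _ col lab).
  move=> u v [el ek ec] le; rewrite /lab -el.
  case lu : (low u) el ec => el ec; rewrite -el in ec.
    have e1 : cusped_proj u = cusped_proj v.
      have e1 : col1 (cusped_proj u) = col1 (cusped_proj v) by exact: inord_inj ec.
      apply: c1bnd => //; apply: c1close => //.
      apply: word_ballW (cusped_walk (hg.1 u v)).
      by rewrite leq_mul // leq_exp2l // leq_add.
    congr inl; move/esym: el => lv; case: u v {ec le} e1 lu lv ek => [x|[[i x] a]] [y|[[j y] b]] //=.
      by move=> ->.
    rewrite /low /= => -> aD bD e; have [||-> ->] // := kind_inj i j a b e; lia.
  move/esym: el => lv; case: u v le lu lv ek ec => [x|[[i x] a]] [y|[[j y] b]] //= le lu lv ek ec.
  have aD : (D <= a)%N by move: lu; rewrite /low /=; lia.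
  have [y' [b' [[e1 e2 e3] h1 h2 h3]]] := horoball_walk (leq_trans le aD) (hg.1 _ _).
  subst j y' b'; have [||_ ab] := kind_inj i i a b ek; [lia|lia|].
  subst b; congr (inr (_, _)); have [_ h _] := hcol2 (i, a).
  apply: h; first exact: inord_inj ec.
  apply: word_ballW h3; rewrite /r leq_mul //; first by lia.
  by rewrite leq_exp2l // leq_add2l.
move=> u v [el ek ec]; rewrite /lab -el.
case lu : (low u) el ec => el ec; rewrite -el in ec.
  by move=> [->]; rewrite (gdist_refl hg).
move/esym: el => lv; case: u v lu lv ek ec => [x|[[i x] a]] [y|[[j y] b]] //= lu lv ek ec [ab].
subst b; have [||ij _] := kind_inj i j a a ek; [lia|lia|]; subst j.
move=> ecell; apply: hg.2; apply: horoball_shortcut.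
have [_ _ h] := hcol2 (i, a); apply: word_ballW (h _ _ _ ecell); last exact: inord_inj ec.
rewrite -addSn expnD /r [X in (_ <= X)%N]mulnC addSn.
apply: leq_trans (_ : k * 2 ^ a.+1 <= _)%N; last by rewrite leq_mul2r (ltnW (ltn_expl _ _)) ?orbT.
by rewrite /k -!mulnA !leq_mul2l -expnD addnC addnS leqnn !orbT.
Qed.

End CuspedSpace.

(** * The classes of groups in the theorem *)

Lemma infinite_torsion_free (G : groupType) (x : G) :
  torsion_free G -> x <> 1%g -> infinite_set [set: G].
Proof.
move=> tf x1 fin; apply: infinite_nat; apply: (@sub_finite_set _ _ ((fun n => x ^+ n)%g @^-1` setT)) => //.
apply: finite_preimage => // m n _ _; wlog mn : m n / (m <= n)%N => [hw e|e].
  by case: (leqP m n) => [|/ltnW] le; [exact: hw|apply/esym/hw].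
apply/eqP; rewrite eqn_leq mn /= leqNgt; apply/negP => lt; apply: x1.
by apply: (tf x (n - m)%N); rewrite ?subn_gt0 // expgnFr // e mulgV.
Qed.

Lemma finite_asdim_nilpotent (R : realType) (G : groupType) (d : G -> G -> R) (m : nat) :
  proper_left_invariant_metric d -> finitely_generated G -> nilpotent_of_class G m ->
  finite_asdim d.
Proof.
move=> hd [S genS] [Lm _]; have [finS _] := genS.
have [s es] := (finite_seqP S).1 finS.
have [c [D h]] : polynomially_bounded (word_ball S).
  rewrite es; apply: (@nilpotent_polynomially_bounded G m _ m) => //; first by rewrite Lm.
  by move=> x _; rewrite subnn.
exact: finite_asdim_of_growth hd genS h.
Qed.

Lemma finite_asdim_hyperbolic (R : realType) (G : groupType) (d : G -> G -> R) :
  proper_left_invariant_metric d -> hyperbolic_group R G -> finite_asdim d.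
Proof.
move=> hd [S [[finS genS] hyp]]; have [g hg] := gdist_cayley genS.
have [D fp] := hyperbolic_four_point (fun x y => graph_distE R x y hg) hyp.
have [C hC] := word_ball_colorable (finite_word_ball hg hd finS (2 * D)).
apply: (finite_asdim_of_word hg hd finS (N := (2 * C)%N)).
apply: (hyperbolic_colorable (B := 0%N) 1%g (@cayley_sym _ _) hg fp).
apply: (colorable_pullback (f := id)) hC => x y.
  by rewrite (gdist1 hg) => /(word_ballP hg).
by move=> ->; rewrite (gdist_refl hg).
Qed.

Lemma finite_asdim_relatively_hyperbolic (R : realType) (G : groupType)
    (d : G -> G -> R) (I : finType) (P : I -> set G) :
  proper_left_invariant_metric d -> relatively_hyperbolic R P ->
  (forall i, qi_embeds_in_trees R (P i)) -> finite_asdim d.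
Proof.
move=> hd [subP [S [[finS genS] genP hyp]]] qi; have [g hg] := gdist_cayley genS.
have [gX hgX] := exists_gdist (@cusped_connected G I P S genS).
have [D fp] := hyperbolic_four_point (fun x y => graph_distE R x y hgX) hyp.
have per i := peripheral_colorable (subP i) (finite_setIl (P i) finS) (genP i) (qi i).
have [N [B hN]] := cusped_colorable hgX (2 * D) (finite_word_ball hg hd finS) per.
have col := hyperbolic_colorable (inl 1%g) (@cusped_adj_sym _ _ P S) hgX fp hN.
apply: (finite_asdim_of_word hg hd finS (N := (2 * N)%N)) => L.
have [B' hB'] := col L; exists (B' * 2 ^ B')%N.
apply: (colorable_pullback (f := inl)) hB' => x y le; last first.
  rewrite (gdist1 hg); apply/(word_ballP hg).
  apply: word_ballW (cusped_walk (hgX.1 (inl x) (inl y))).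
  by rewrite leq_mul // leq_exp2l.
by apply: leq_trans le; apply: hgX.2; apply: walk_cusped_inl; exact: hg.1.
Qed.

Theorem theoremB (R : realType) :
  (forall (G : groupType) (d : G -> G -> R) (m : nat),
     proper_left_invariant_metric d ->
     finitely_generated G -> torsion_free G -> nilpotent_of_class G m ->
     DTUT d m 0)
  /\
  (forall (G : groupType) (d : G -> G -> R),
     proper_left_invariant_metric d ->
     finitely_generated G -> polynomial_growth G ->
     exists m : nat, DTUT d m 0)
  /\
  (forall (G : groupType) (d : G -> G -> R),
     proper_left_invariant_metric d ->
     hyperbolic_group R G ->
     has_DTUT d /\ (infinite_set [set: G] -> DTUT d 1 0))
  /\
  (forall (G : groupType) (d : G -> G -> R) (I : finType) (P : I -> set G),
     proper_left_invariant_metric d ->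
     relatively_hyperbolic R P ->
     (forall i, qi_embeds_in_trees R (P i)) ->
     has_DTUT d /\ (infinite_set [set: G] -> DTUT d 1 0)).
Proof.
have infDTUT (G : groupType) (d : G -> G -> R) m : proper_left_invariant_metric d ->
    finite_asdim d -> infinite_set [set: G] -> DTUT d m.+1 0.
  by move=> [md _ fin] fd inf; exact: DTUT_of_finite_asdim.
have finDTUT (G : groupType) (d : G -> G -> R) : proper_left_invariant_metric d ->
    finite_set [set: G] -> DTUT d 0 0.
  by move=> [md _ _]; exact: DTUT_of_finite.
have hasDTUT (G : groupType) (d : G -> G -> R) : proper_left_invariant_metric d ->
    finite_asdim d -> has_DTUT d /\ (infinite_set [set: G] -> DTUT d 1 0).
  move=> hd fd; split; last exact: infDTUT.
  have [fin|inf] := pselect (finite_set [set: G]).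
    by exists 0%N, 0%N; exact: finDTUT.
  by exists 1%N, 0%N; exact: infDTUT.
split; [|split; [|split]].
- move=> G d [|m] hd fg tf nil.
    (* Class [0] means the trivial group; in positive class a nontrivial element has infinite
       order. *)
    apply: finDTUT => //; have [L0 _] := nil.
    by have -> : [set: G] = [set 1%g] by exact: L0.
  apply: infDTUT => //; first exact: finite_asdim_nilpotent nil.
  have [_ /(_ 0%N isT) L0] := nil.
  have [x x1] : exists x : G, x <> 1%g.
    apply: contrapT => no; apply: L0; apply/seteqP; split=> // x _.
    by apply: contrapT => x1; apply: no; exists x.
  exact: infinite_torsion_free x1.
- move=> G d hd _ pg; have [fin|inf] := pselect (finite_set [set: G]).
    by exists 0%N; exact: finDTUT.
  by exists 1%N; apply: infDTUT => //; exact: finite_asdim_of_polynomial_growth.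
- by move=> G d hd hyp; apply: hasDTUT => //; exact: finite_asdim_hyperbolic.
- move=> G d I P hd rh qi; apply: hasDTUT => //.
  exact: finite_asdim_relatively_hyperbolic rh qi.
Qed.
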